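(* Let $T\in\{DPO,SPO_A,SPO_B,SPO_{AB}\}$ and let $\mathcal R_{\mathcal V}\subset\mathcal R_T$ be the vertex algebra, i.e. the (unital) subalgebra generated by $a^\dagger,I,a$. Then $\mathcal R_{\mathcal V}$ is presented as $$\mathcal R_{\mathcal V}\cong\frac{\mathbb K\langle a^\dagger,I,a\rangle}{\langle\,[a,a^\dagger]-r_\emptyset,\ [a,I]-a,\ [I,a^\dagger]-a^\dagger\,\rangle},$$ where $\mathbb K\langle a^\dagger,I,a\rangle$ is the free monoid algebra on words in the generators (with algebra operation $*$), the empty word is identified with $r_\emptyset$, and the denominator is the two-sided ideal generated by the displayed relations. Moreover, with respect to the normal ordering (total order) $a^\dagger\prec I\prec a$ on the generators, every element of $\mathcal R_{\mathcal V}$ can be expressed as a linear combination of the normal ordered terms $V(m,n,p):=(a^\dagger)^{*m}*I^{*n}*a^{*p}$, $m,n,p\in\mathbb Z_{\ge0}$.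
   Context: $\mathbb K$ is a field (such as $\mathbb R$ or $\mathbb C$); $*=*_T$ below denotes the product of the rule algebra $\mathcal R_T$ and $[x,y]=x*y-y*x$. Graphs are finite directed multigraphs. A linear rule $r:I\rightharpoonup O$ is an injective partial graph morphism: a pair of one-to-one relations $r\subseteq(V_I\times V_O)\uplus(E_I\times E_O)$ (distinct pairs differ in both entries) with $(e,e')\in r\Rightarrow(s(e),s(e')),(t(e),t(e'))\in r$ for edges. $[I,O,r]$ denotes its isomorphism class (under pairs of graph isomorphisms of $I$ and of $O$). The vector space underlying $\mathcal R_T$ has as basis the isomorphism classes of linear rules, $\delta([I,O,r])$ being the basis vectors; $r_\emptyset=\delta([\emptyset,\emptyset,\emptyset])$. Product. For rules $\rho_1=[I_1,O_1,r_1]$, $\rho_2=[I_2,O_2,r_2]$ a match is a one-to-one relation $m$ from $O_2$ to $I_1$ (vertices to vertices, edges to edges, possibly empty) such that for matched edges $(e,e')\in m$ also $(s(e),s(e')),(t(e),t(e'))\in m$. The composite along $m$ has interfaces $\mathcal I=I_2\uplus(I_1\setminus\mathrm{im}(m))$, $\mathcal O=O_1\uplus(O_2\setminus\mathrm{dom}(m))$; the relation from $\mathcal I$ to $\mathcal O$ relates two elements if they are connected by following $r_2$, $m$, $r_1$ (i.e. it is the restriction of $r_1\cup r_2\cup (r_1\circ m\circ r_2)$). Source and target in $\mathcal I$: an edge of $I_1$ whose endpoint $v\in I_1$ is matched, $(v',v)\in m$, gets as endpoint the $w\in I_2$ with $(w,v')\in r_2$ if it exists, and otherwise the endpoint is missing;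 in $\mathcal O$: an edge of $O_2$ whose endpoint $v'$ is matched, $(v',v)\in m$, gets as endpoint the $w\in O_1$ with $(v,w)\in r_1$ if it exists, and otherwise it is missing; all other endpoints are unchanged. Edges with a missing endpoint are called dangling. The reduction of type $T$: for $DPO$ the composite is replaced by $0$ if there is a dangling edge; for $SPO_A$ dangling edges in $\mathcal O$ are deleted (the relation is restricted) and the result is $0$ if there are dangling edges in $\mathcal I$; for $SPO_B$ dangling edges in $\mathcal I$ are deleted and the result is $0$ if there are dangling edges in $\mathcal O$; for $SPO_{AB}$ all dangling edges are deleted. $\delta(\rho_1)*_T\delta(\rho_2)$ is the sum over all matches $m$ of the reduced composites, extended bilinearly. $\mathcal R_T$ is an associative algebra with unit $r_\emptyset$. Generators. With $\bullet$ the one-vertex graph without edges: $a^\dagger:=\delta([\emptyset,\bullet,\emptyset])$ (vertex creation), $a:=\delta([\bullet,\emptyset,\emptyset])$ (vertex deletion), $I:=\delta([\bullet,\bullet,\mathrm{id}_\bullet])$ (vertex preservation). *)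

(* Defs.v *)
From HB Require Import structures.
From mathcomp Require Import all_boot all_order all_algebra.
From mathcomp Require Import boolp finmap monalg.

Set Implicit Arguments.
Unset Strict Implicit.
Unset Printing Implicit Defensive.

Import GRing.Theory.
Local Open Scope ring_scope.
Local Open Scope quotient_scope.

(* A graph with vertex set [option V] is used for a graph on [V] some of whose
   edge endpoints are missing. *)
Record graph (V E : Type) := Graph { src : E -> V; tgt : E -> V }.

Definition one_to_one (A B : finType) (r : {set A * B}) : bool :=
  [forall p in r, forall q in r, (p != q) ==> (p.1 != q.1) && (p.2 != q.2)].

(* Injective partial graph morphisms G -> H, as pairs of relations (on vertices
   and on edges).  They serve both as linear rules and as matches. *)
Definition inj_pmor (VG EG VH EH : finType) (G : graph VG EG) (H : graph VH EH)
    (r : {set VG * VH} * {set EG * EH}) : bool :=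
  [&& one_to_one r.1, one_to_one r.2 &
      [forall e in r.2, ((src G e.1, src H e.2) \in r.1) &&
                        ((tgt G e.1, tgt H e.2) \in r.1)]].

Record rule (VI EI VO EO : finType) := Rule {
  inp : graph VI EI;
  out : graph VO EO;
  rule_rel : {set VI * VO} * {set EI * EO};
  rule_relP : inj_pmor inp out rule_rel }.

Definition graph_iso (V E V' E' : Type) (G : graph V E) (G' : graph V' E')
    (fV : V -> V') (fE : E -> E') : Prop :=
  [/\ bijective fV, bijective fE,
      forall e, src G' (fE e) = fV (src G e) &
      forall e, tgt G' (fE e) = fV (tgt G e)].

Definition rule_iso (VI EI VO EO VI' EI' VO' EO' : finType)
    (r : rule VI EI VO EO) (r' : rule VI' EI' VO' EO') : Prop :=
  exists fV fE gV gE,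
    [/\ graph_iso (inp r) (inp r') fV fE, graph_iso (out r) (out r') gV gE,
        forall x y, ((fV x, gV y) \in (rule_rel r').1) = ((x, y) \in (rule_rel r).1) &
        forall x y, ((fE x, gE y) \in (rule_rel r').2) = ((x, y) \in (rule_rel r).2)].

(* Isomorphism classes of linear rules.  To get a small type of classes, the
   vertices and edges of the representatives are numbered. *)
Record numbered_rule := NumberedRule {
  nVI : nat; nEI : nat; nVO : nat; nEO : nat;
  body : rule 'I_nVI 'I_nEI 'I_nVO 'I_nEO }.

HB.instance Definition _ := gen_eqMixin numbered_rule.
HB.instance Definition _ := gen_choiceMixin numbered_rule.

Definition numbered_iso (r r' : numbered_rule) : bool :=
  `[< rule_iso (body r) (body r') >].

Lemma graph_iso_id (V E : Type) (G : graph V E) : graph_iso G G id id.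
Proof. by split=> //; exists id. Qed.

Lemma graph_iso_inv (V E V' E' : Type) (G : graph V E) (G' : graph V' E')
    fV fE : graph_iso G G' fV fE -> forall fV' fE', cancel fV fV' ->
    cancel fV' fV -> cancel fE fE' -> cancel fE' fE -> graph_iso G' G fV' fE'.
Proof.
move=> [_ _ hs ht] fV' fE' kV kV' kE kE'; split; first by exists fV.
- by exists fE.
- by move=> e; rewrite -{2}[e]kE' hs kV.
- by move=> e; rewrite -{2}[e]kE' ht kV.
Qed.

Lemma graph_iso_comp (V E V' E' V'' E'' : Type) (G : graph V E)
    (G' : graph V' E') (G'' : graph V'' E'') fV fE gV gE :
  graph_iso G G' fV fE -> graph_iso G' G'' gV gE ->
  graph_iso G G'' (gV \o fV) (gE \o fE).
Proof.
move=> [bV bE hs ht] [bV' bE' hs' ht']; split; try exact: bij_comp.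
- by move=> e /=; rewrite hs' hs.
- by move=> e /=; rewrite ht' ht.
Qed.

Lemma rule_iso_refl (VI EI VO EO : finType) (r : rule VI EI VO EO) :
  rule_iso r r.
Proof.
by exists id, id, id, id; split=> //; exact: graph_iso_id.
Qed.

Lemma rule_iso_sym (VI EI VO EO VI' EI' VO' EO' : finType)
    (r : rule VI EI VO EO) (r' : rule VI' EI' VO' EO') :
  rule_iso r r' -> rule_iso r' r.
Proof.
move=> [fV [fE [gV [gE [hI hO hV hE]]]]].
have [[fV' kV kV'] [fE' kE kE'] _ _] := hI.
have [[gV' lV lV'] [gE' lE lE'] _ _] := hO.
exists fV', fE', gV', gE'; split.
- exact: graph_iso_inv hI _ _ kV kV' kE kE'.
- exact: graph_iso_inv hO _ _ lV lV' lE lE'.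
- by move=> x y; rewrite -hV kV' lV'.
- by move=> x y; rewrite -hE kE' lE'.
Qed.

Lemma rule_iso_trans (VI EI VO EO VI' EI' VO' EO' VI'' EI'' VO'' EO'' : finType)
    (r : rule VI EI VO EO) (r' : rule VI' EI' VO' EO')
    (r'' : rule VI'' EI'' VO'' EO'') :
  rule_iso r r' -> rule_iso r' r'' -> rule_iso r r''.
Proof.
move=> [fV [fE [gV [gE [hI hO hV hE]]]]] [fV' [fE' [gV' [gE' [hI' hO' hV' hE']]]]].
exists (fV' \o fV), (fE' \o fE), (gV' \o gV), (gE' \o gE); split.
- exact: graph_iso_comp hI hI'.
- exact: graph_iso_comp hO hO'.
- by move=> x y /=; rewrite hV' hV.
- by move=> x y /=; rewrite hE' hE.
Qed.

Lemma numbered_iso_equiv : equiv_class_of numbered_iso.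
Proof.
split=> [r|r r'|r' r r''].
- exact/asboolP/rule_iso_refl.
- by apply/asboolP/asboolP; exact: rule_iso_sym.
- by move=> /asboolP h /asboolP h'; apply/asboolP; exact: rule_iso_trans h h'.
Qed.

Canonical numbered_iso_rel := EquivRelPack numbered_iso_equiv.

Definition rule_class := {eq_quot numbered_iso}.
HB.instance Definition _ := Choice.on rule_class.
HB.instance Definition _ : EqQuotient numbered_rule numbered_iso rule_class :=
  EqQuotient.on rule_class.

Definition number_graph (V E : finType) (G : graph V E) : graph 'I_#|V| 'I_#|E| :=
  Graph (fun e => enum_rank (src G (enum_val e)))
        (fun e => enum_rank (tgt G (enum_val e))).

Definition number_rel (A B : finType) (r : {set A * B}) :
    {set 'I_#|A| * 'I_#|B|} :=
  [set p | (enum_val p.1, enum_val p.2) \in r].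

Lemma one_to_oneP (A B : finType) (r : {set A * B}) :
  reflect ((forall x y y', (x, y) \in r -> (x, y') \in r -> y = y') /\
           (forall x x' y, (x, y) \in r -> (x', y) \in r -> x = x'))
          (one_to_one r).
Proof.
apply: (iffP forall_inP) => [h|[hl hr] [x y] hp]; last first.
  apply/forall_inP => -[x' y'] hq; apply/implyP; rewrite xpair_eqE negb_and /=.
  case: eqVneq hq => [<-|/= nx] hq /=; first by rewrite (hl _ _ _ hp hq) eqxx.
  by case: eqVneq hq => // <- hq; rewrite (hr _ _ _ hp hq) eqxx in nx.
split=> [x y y'|x x' y] h1 h2; apply/eqP; apply: contraT => ne;
  have /forall_inP/(_ _ h2)/implyP := h _ h1;
  by rewrite xpair_eqE negb_and ne ?orbT /= eqxx ?andbF => /(_ isT).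
Qed.

Lemma number_one_to_one (A B : finType) (r : {set A * B}) :
  one_to_one r -> one_to_one (number_rel r).
Proof.
move=> /one_to_oneP[hl hr]; apply/one_to_oneP; split=> [x y y'|x x' y];
  rewrite !inE /= => h1 h2; apply: enum_val_inj; [exact: hl h1 h2|exact: hr h1 h2].
Qed.

Lemma number_relP (VI EI VO EO : finType) (r : rule VI EI VO EO) :
  inj_pmor (number_graph (inp r)) (number_graph (out r))
           (number_rel (rule_rel r).1, number_rel (rule_rel r).2).
Proof.
have /and3P[hV hE /forall_inP h] := rule_relP r.
apply/and3P; split; [exact: number_one_to_one|exact: number_one_to_one|].
apply/forall_inP => e; rewrite /= !inE /= => /h /=.
by rewrite !enum_rankK.
Qed.

Definition number_rule (VI EI VO EO : finType) (r : rule VI EI VO EO) :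
  numbered_rule := NumberedRule (Rule (number_relP r)).

Definition class_of (VI EI VO EO : finType) (r : rule VI EI VO EO) : rule_class :=
  \pi_rule_class (number_rule r).

Lemma number_rule_iso (VI EI VO EO : finType) (r : rule VI EI VO EO) :
  rule_iso r (body (number_rule r)).
Proof.
exists enum_rank, enum_rank, enum_rank, enum_rank.
split; try by [split=> [||e|e] /=; rewrite ?enum_rankK //; exact: enum_rank_bij].
- by move=> x y; rewrite inE /= !enum_rankK.
- by move=> x y; rewrite inE /= !enum_rankK.
Qed.

Lemma class_of_eq (VI EI VO EO VI' EI' VO' EO' : finType)
    (r : rule VI EI VO EO) (r' : rule VI' EI' VO' EO') :
  class_of r = class_of r' <-> rule_iso r r'.
Proof.
split=> [/eqmodP/asboolP h|h].
  apply: rule_iso_trans (number_rule_iso r) (rule_iso_trans h _).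
  exact/rule_iso_sym/number_rule_iso.
apply/eqmodP/asboolP; apply: rule_iso_trans (number_rule_iso r').
by apply: rule_iso_trans h; exact/rule_iso_sym/number_rule_iso.
Qed.

Definition match_of (VI1 EI1 VO1 EO1 VI2 EI2 VO2 EO2 : finType)
    (r1 : rule VI1 EI1 VO1 EO1) (r2 : rule VI2 EI2 VO2 EO2) : finType :=
  {m : {set VO2 * VI1} * {set EO2 * EI1} | inj_pmor (out r2) (inp r1) m}.

Definition rel_dom (A B : finType) (m : {set A * B}) : {set A} := [set p.1 | p in m].
Definition rel_im (A B : finType) (m : {set A * B}) : {set B} := [set p.2 | p in m].

Section ComposeRelations.
Variables (I1 O1 I2 O2 : finType).
Variables (r1 : {set I1 * O1}) (m : {set O2 * I1}) (r2 : {set I2 * O2}).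

(* I_2 + (I_1 \ im m) and O_1 + (O_2 \ dom m), for vertices or for edges. *)
Definition comp_I : finType := (I2 + {x : I1 | x \notin rel_im m})%type.
Definition comp_O : finType := (O1 + {y : O2 | y \notin rel_dom m})%type.

Definition comp_rel : {set comp_I * comp_O} :=
  [set p | match p.1, p.2 with
           | inl a, inl b => [exists y, exists x,
               [&& (a, y) \in r2, (y, x) \in m & (x, b) \in r1]]
           | inl a, inr y => (a, val y) \in r2
           | inr x, inl b => (val x, b) \in r1
           | inr _, inr _ => false
           end].

(* New endpoint of an edge of I_1 \ im m whose endpoint in I_1 was v. *)
Definition endpoint_I (v : I1) : option comp_I :=
  if insub v is Some u then Some (inr u)
  else omap inl [pick w | [exists v', ((v', v) \in m) && ((w, v') \in r2)]].

(* New endpoint of an edge of O_2 \ dom m whose endpoint in O_2 was v'. *)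
Definition endpoint_O (v' : O2) : option comp_O :=
  if insub v' is Some u then Some (inr u)
  else omap inl [pick w | [exists v, ((v', v) \in m) && ((v, w) \in r1)]].

End ComposeRelations.

Definition dangling (V E : Type) (G : graph (option V) E) (e : E) : bool :=
  ~~ (isSome (src G e) && isSome (tgt G e)).

Definition oval (T : Type) (x : option T) : isSome x -> T :=
  match x with
  | Some v => fun _ => v
  | None => fun h => False_rect T (notF h)
  end.

Lemma src_isSome (V E : Type) (G : graph (option V) E) e :
  ~~ dangling G e -> isSome (src G e).
Proof. by rewrite negbK => /andP[]. Qed.

Lemma tgt_isSome (V E : Type) (G : graph (option V) E) e :
  ~~ dangling G e -> isSome (tgt G e).
Proof. by rewrite negbK => /andP[]. Qed.

Definition delete_dangling (V : Type) (E : finType) (G : graph (option V) E) :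
    graph V {e | ~~ dangling G e} :=
  Graph (fun e => oval (src_isSome (valP e))) (fun e => oval (tgt_isSome (valP e))).

Section Composite.
Variables (VI1 EI1 VO1 EO1 VI2 EI2 VO2 EO2 : finType).
Variables (r1 : rule VI1 EI1 VO1 EO1) (r2 : rule VI2 EI2 VO2 EO2).
Variable m : match_of r1 r2.

Let mV : {set VO2 * VI1} := (val m).1.
Let mE : {set EO2 * EI1} := (val m).2.

Definition composite_inp :
    graph (option (comp_I VI2 mV)) (comp_I EI2 mE) :=
  let endpoint st2 st1 e := match e with
    | inl e => Some (inl (st2 e))
    | inr e => endpoint_I mV (rule_rel r2).1 (st1 (val e))
    end in
  Graph (endpoint (src (inp r2)) (src (inp r1)))
        (endpoint (tgt (inp r2)) (tgt (inp r1))).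

Definition composite_out :
    graph (option (comp_O VO1 mV)) (comp_O EO1 mE) :=
  let endpoint st1 st2 e := match e with
    | inl e => Some (inl (st1 e))
    | inr e => endpoint_O (rule_rel r1).1 mV (st2 (val e))
    end in
  Graph (endpoint (src (out r1)) (src (out r2)))
        (endpoint (tgt (out r1)) (tgt (out r2))).

Definition composite_relV := comp_rel (rule_rel r1).1 mV (rule_rel r2).1.
Definition composite_relE := comp_rel (rule_rel r1).2 mE (rule_rel r2).2.

Definition reduct_relE :
    {set {e | ~~ dangling composite_inp e} * {e | ~~ dangling composite_out e}} :=
  [set p | (val p.1, val p.2) \in composite_relE].

End Composite.

Lemma comp_one_to_one (I1 O1 I2 O2 : finType) (r1 : {set I1 * O1})
    (m : {set O2 * I1}) (r2 : {set I2 * O2}) :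
  one_to_one r1 -> one_to_one m -> one_to_one r2 -> one_to_one (comp_rel r1 m r2).
Proof.
move=> /one_to_oneP[l1 c1] /one_to_oneP[lm cm] /one_to_oneP[l2 c2].
have nD (y : O2) x : (y, x) \in m -> y \in rel_dom m.
  by move=> h; apply/imsetP; exists (y, x).
have nI (y : O2) x : (y, x) \in m -> x \in rel_im m.
  by move=> h; apply/imsetP; exists (y, x).
apply/one_to_oneP; split.
- move=> [a|x] [b|y] [b'|y']; rewrite !inE //=.
  + move=> /existsP[y /existsP[x /and3P[h1 h2 h3]]].
    move=> /existsP[y' /existsP[x' /and3P[h1' h2' h3']]].
    have ? := l2 _ _ _ h1 h1'; subst y'.
    have ? := lm _ _ _ h2 h2'; subst x'.
    by rewrite (l1 _ _ _ h3 h3').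
  + move=> /existsP[y /existsP[x /and3P[h1 h2 h3]]] h.
    by have := valP y'; rewrite /= -(l2 _ _ _ h1 h) (nD _ _ h2).
  + move=> h /existsP[y' /existsP[x /and3P[h1 h2 h3]]].
    by have := valP y; rewrite /= -(l2 _ _ _ h1 h) (nD _ _ h2).
  + by move=> h h'; congr inr; apply: val_inj; exact: l2 h h'.
  + by move=> h h'; rewrite (l1 _ _ _ h h').
- move=> [a|x] [a'|x'] [b|y]; rewrite !inE //=.
  + move=> /existsP[y /existsP[x /and3P[h1 h2 h3]]].
    move=> /existsP[y' /existsP[x' /and3P[h1' h2' h3']]].
    have ? := c1 _ _ _ h3 h3'; subst x'.
    have ? := cm _ _ _ h2 h2'; subst y'.
    by rewrite (c2 _ _ _ h1 h1').
  + by move=> h h'; rewrite (c2 _ _ _ h h').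
  + move=> /existsP[y /existsP[x /and3P[h1 h2 h3]]] h.
    by have := valP x'; rewrite /= -(c1 _ _ _ h3 h) (nI _ _ h2).
  + move=> h /existsP[y /existsP[x' /and3P[h1 h2 h3]]].
    by have := valP x; rewrite /= -(c1 _ _ _ h3 h) (nI _ _ h2).
  + by move=> h h'; congr inr; apply: val_inj; exact: c1 h h'.
Qed.

Lemma endpoint_O_rel (I1 O1 I2 O2 : finType) (r1 : {set I1 * O1})
    (m : {set O2 * I1}) (r2 : {set I2 * O2}) a v' w :
  one_to_one m -> (a, v') \in r2 -> endpoint_O r1 m v' = Some w ->
  (inl a, w) \in comp_rel r1 m r2.
Proof.
move=> /one_to_oneP[lm cm] h; rewrite /endpoint_O.
case: insubP => [u _ <-|nv] /= in h *; first by move=> [<-]; rewrite inE.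
case: pickP => [w' /existsP[v /andP[h1 h2]]|//] /= [<-].
by rewrite inE /=; apply/existsP; exists v'; apply/existsP; exists v; apply/and3P.
Qed.

Lemma endpoint_I_rel (I1 O1 I2 O2 : finType) (r1 : {set I1 * O1})
    (m : {set O2 * I1}) (r2 : {set I2 * O2}) b v w :
  one_to_one m -> (v, b) \in r1 -> endpoint_I m r2 v = Some w ->
  (w, inl b) \in comp_rel r1 m r2.
Proof.
move=> /one_to_oneP[lm cm] h; rewrite /endpoint_I.
case: insubP => [u _ <-|nv] /= in h *; first by move=> [<-]; rewrite inE.
case: pickP => [w' /existsP[v' /andP[h1 h2]]|//] /= [<-].
by rewrite inE /=; apply/existsP; exists v'; apply/existsP; exists v; apply/and3P.
Qed.

Lemma oval_some (T : Type) (x : option T) (h : isSome x) : x = Some (oval h).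
Proof. by case: x h. Qed.

Lemma reductP (VI1 EI1 VO1 EO1 VI2 EI2 VO2 EO2 : finType)
    (r1 : rule VI1 EI1 VO1 EO1) (r2 : rule VI2 EI2 VO2 EO2) (m : match_of r1 r2) :
  inj_pmor (delete_dangling (composite_inp m)) (delete_dangling (composite_out m))
           (composite_relV m, reduct_relE m).
Proof.
have /and3P[V1 E1 /forall_inP h1] := rule_relP r1.
have /and3P[V2 E2 /forall_inP h2] := rule_relP r2.
have /and3P[Vm Em /forall_inP hm] := valP m.
have hV : one_to_one (composite_relV m) by exact: comp_one_to_one.
have /one_to_oneP[El Ec] : one_to_one (composite_relE m) by exact: comp_one_to_one.
have memE x y : ((x, y) \in reduct_relE m) = ((val x, val y) \in composite_relE m).
  by rewrite /reduct_relE in_set.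
apply/and3P; split=> //.
  apply/one_to_oneP; split=> [x y y'|x x' y] /=; rewrite !memE => a b.
    by apply: val_inj; exact: El a b.
  by apply: val_inj; exact: Ec a b.
apply/forall_inP => -[e e'] /=; rewrite memE => he.
move: (src_isSome (valP e)) (tgt_isSome (valP e)).
move: (src_isSome (valP e')) (tgt_isSome (valP e')).
case: e e' he => [e ne] [e' ne'] /=; move: e e' {ne ne'} => [e|e] [e'|e'] /=;
  rewrite /composite_relE inE //=.
- move=> /existsP[y /existsP[x /and3P[k1 k2 k3]]] _ _ _ _; rewrite !inE /=.
  have /andP[/= s2 t2] := h2 _ k1.
  have /andP[/= sm tm] := hm _ k2.
  have /andP[/= s1 t1] := h1 _ k3.
  apply/andP; split; apply/existsP; eexists; apply/existsP; eexists;
    apply/and3P; split; [exact: s2|exact: sm|exact: s1|exact: t2|exact: tm|exact: t1].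
- move=> k p q _ _; have /andP[/= s2 t2] := h2 _ k.
  by apply/andP; split; [apply: endpoint_O_rel s2 (oval_some p)
                        |apply: endpoint_O_rel t2 (oval_some q)].
- move=> k _ _ p q; have /andP[/= s1 t1] := h1 _ k.
  by apply/andP; split; [apply: endpoint_I_rel s1 (oval_some p)
                        |apply: endpoint_I_rel t1 (oval_some q)].
Qed.

Definition empty_graph : graph void void := Graph (of_void _) (of_void _).
Definition one_vertex_graph : graph unit void := Graph (of_void _) (of_void _).

Lemma edgeless_pmor (V W : finType) (G : graph V void) (H : graph W void)
    (rV : {set V * W}) : one_to_one rV -> inj_pmor G H (rV, set0).
Proof.
move=> hV; apply/and3P; split=> //; last by apply/forall_inP => -[].
by apply/one_to_oneP; split=> [[]|[]].
Qed.

Lemma set0_one_to_one (A B : finType) : one_to_one (set0 : {set A * B}).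
Proof. by apply/one_to_oneP; split=> ? ? ?; rewrite inE. Qed.

Lemma unit_one_to_one : one_to_one [set (tt, tt)].
Proof. by apply/one_to_oneP; split=> -[] [] []. Qed.

Definition empty_rule : rule void void void void :=
  Rule (edgeless_pmor empty_graph empty_graph (set0_one_to_one _ _)).
Definition create_rule : rule void void unit void :=
  Rule (edgeless_pmor empty_graph one_vertex_graph (set0_one_to_one _ _)).
Definition delete_rule : rule unit void void void :=
  Rule (edgeless_pmor one_vertex_graph empty_graph (set0_one_to_one _ _)).
Definition preserve_rule : rule unit void unit void :=
  Rule (edgeless_pmor one_vertex_graph one_vertex_graph unit_one_to_one).

Inductive rewriting_type := DPO | SPO_A | SPO_B | SPO_AB.

(* In increasing normal order. *)
Inductive generator := Gadag | GI | Ga.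

Definition ord_of_generator (g : generator) : 'I_3 :=
  match g with Gadag => inord 0 | GI => inord 1 | Ga => inord 2 end.
Definition generator_of_ord (i : 'I_3) : generator :=
  match val i with 0%N => Gadag | 1%N => GI | _ => Ga end.
Lemma ord_of_generatorK : cancel ord_of_generator generator_of_ord.
Proof. by case; rewrite /generator_of_ord /= inordK. Qed.
HB.instance Definition _ := Finite.copy generator (can_type ord_of_generatorK).

Section RuleAlgebra.
Variables (K : fieldType) (T : rewriting_type).

(* Only the product of the rule algebra depends on T. *)
Definition rule_algebra : Type := {malg K[rule_class]}.
HB.instance Definition _ := GRing.Lmodule.on rule_algebra.

Definition delta (VI EI VO EO : finType) (r : rule VI EI VO EO) : rule_algebra :=
  << class_of r >>.

(* Whether the reduction of type T is nonzero; if so, it consists in deleting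
   the remaining dangling edges (there are none for DPO). *)
Definition admissible (VI1 EI1 VO1 EO1 VI2 EI2 VO2 EO2 : finType)
    (r1 : rule VI1 EI1 VO1 EO1) (r2 : rule VI2 EI2 VO2 EO2) (m : match_of r1 r2) : bool :=
  let noI := [forall e, ~~ dangling (composite_inp m) e] in
  let noO := [forall e, ~~ dangling (composite_out m) e] in
  match T with
  | DPO => noI && noO
  | SPO_A => noI
  | SPO_B => noO
  | SPO_AB => true
  end.

Definition reduced_composite (VI1 EI1 VO1 EO1 VI2 EI2 VO2 EO2 : finType)
    (r1 : rule VI1 EI1 VO1 EO1) (r2 : rule VI2 EI2 VO2 EO2) (m : match_of r1 r2) :
    rule_algebra :=
  if admissible m then delta (Rule (reductP m)) else 0.

(* The sum does not depend on the representatives: an isomorphism of rules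
   transports matches to matches with isomorphic reduced composites. *)
Definition mul_classes (c1 c2 : rule_class) : rule_algebra :=
  \sum_(m : match_of (body (repr c1)) (body (repr c2))) reduced_composite m.

Definition rmul (x y : rule_algebra) : rule_algebra :=
  \sum_(c1 <- msupp x) \sum_(c2 <- msupp y) (x@_c1 * y@_c2) *: mul_classes c1 c2.

Definition r_empty : rule_algebra := delta empty_rule.

Definition rpow (x : rule_algebra) (n : nat) : rule_algebra :=
  iter n (rmul x) r_empty.

Definition gen_value (g : generator) : rule_algebra :=
  match g with
  | Gadag => delta create_rule
  | GI => delta preserve_rule
  | Ga => delta delete_rule
  end.

Definition unital_subalgebra (S : rule_algebra -> Prop) : Prop :=
  [/\ S r_empty,
      forall (c : K) x y, S x -> S y -> S (c *: x + y) &
      forall x y, S x -> S y -> S (rmul x y)].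

Definition vertex_algebra (x : rule_algebra) : Prop :=
  forall S, unital_subalgebra S -> (forall g, S (gen_value g)) -> S x.

Definition normal_term (m n p : nat) : rule_algebra :=
  rmul (rmul (rpow (gen_value Gadag) m) (rpow (gen_value GI) n))
       (rpow (gen_value Ga) p).

End RuleAlgebra.

Section QuotientAlgebra.
Variables (K : fieldType) (A : lalgType K) (S : A -> Prop).

Definition two_sided_ideal (J : A -> Prop) : Prop :=
  [/\ J 0, forall x y, J x -> J y -> J (x - y),
      forall a x, J x -> J (a * x) & forall a x, J x -> J (x * a)].

Definition ideal_gen : {pred A} := fun x =>
  `[< forall J, two_sided_ideal J -> (forall s, S s -> J s) -> J x >].

Lemma ideal_genP : two_sided_ideal (fun x => x \in ideal_gen).
Proof.
split=> [|x y /asboolP hx /asboolP hy|a x /asboolP hx|a x /asboolP hx];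
  apply/asboolP => J hJ hS; have [J0 JB Jl Jr] := hJ.
- by [].
- by apply: JB; [exact: hx|exact: hy].
- by apply: Jl; exact: hx.
- by apply: Jr; exact: hx.
Qed.

Lemma ideal_gen_zmod : zmod_closed ideal_gen.
Proof. by have [J0 JB _ _] := ideal_genP. Qed.

HB.instance Definition _ := GRing.isZmodClosed.Build A ideal_gen ideal_gen_zmod.

(* ring_quotient only provides the ring structure for commutative rings. *)
Definition quotient_algebra : Type := Quotient.quot ideal_gen.
HB.instance Definition _ := GRing.Zmodule.on quotient_algebra.
HB.instance Definition _ := EqQuotient.on quotient_algebra.

Local Notation Q := quotient_algebra.

Definition quotient_pi (x : A) : Q := \pi_Q x.

Lemma quotient_piP x y : quotient_pi x = quotient_pi y <-> x - y \in ideal_gen.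
Proof.
by rewrite Quotient.idealrBE; split=> [h|/eqP //]; apply/eqP.
Qed.

Lemma quotient_reprP x : repr (quotient_pi x) - x \in ideal_gen.
Proof. by apply/quotient_piP; rewrite /quotient_pi reprK. Qed.

Lemma quotient_piD : {morph quotient_pi : x y / x + y}.
Proof. by move=> x y; rewrite /quotient_pi piE. Qed.

Definition quotient_mul (x y : Q) : Q := quotient_pi (repr x * repr y).
Definition quotient_scale (c : K) (x : Q) : Q := quotient_pi (c *: repr x).

Lemma quotient_piM x y :
  quotient_mul (quotient_pi x) (quotient_pi y) = quotient_pi (x * y).
Proof.
have [_ _ Jl Jr] := ideal_genP; apply/quotient_piP.
set x' := repr _; set y' := repr _.
have -> : x' * y' - x * y = (x' - x) * y' + x * (y' - y).
  by rewrite mulrBl mulrBr addrA subrK.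
by rewrite rpredD //; [apply: Jr|apply: Jl]; exact: quotient_reprP.
Qed.

Lemma quotient_piZ c x :
  quotient_scale c (quotient_pi x) = quotient_pi (c *: x).
Proof.
have [_ _ Jl _] := ideal_genP; apply/quotient_piP.
rewrite -scalerBr -[_ - _]mul1r scalerAl; apply: Jl; exact: quotient_reprP.
Qed.

Lemma quotient_ind (P : Q -> Prop) :
  (forall x, P (quotient_pi x)) -> forall x, P x.
Proof. by move=> h x; rewrite -[x]reprK; exact: h. Qed.

Lemma quotient_mulA : associative quotient_mul.
Proof.
by do 3 elim/quotient_ind => ?; rewrite !quotient_piM mulrA.
Qed.

Lemma quotient_mul1 : left_id (quotient_pi 1) quotient_mul.
Proof. by elim/quotient_ind => x; rewrite quotient_piM mul1r. Qed.

Lemma quotient_mulr1 : right_id (quotient_pi 1) quotient_mul.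
Proof. by elim/quotient_ind => x; rewrite quotient_piM mulr1. Qed.

Lemma quotient_mulDl : left_distributive quotient_mul +%R.
Proof.
do 3 elim/quotient_ind => ?.
by rewrite -quotient_piD !quotient_piM mulrDl quotient_piD.
Qed.

Lemma quotient_mulDr : right_distributive quotient_mul +%R.
Proof.
do 3 elim/quotient_ind => ?.
by rewrite -quotient_piD !quotient_piM mulrDr quotient_piD.
Qed.

HB.instance Definition _ := GRing.Zmodule_isPzRing.Build Q
  quotient_mulA quotient_mul1 quotient_mulr1 quotient_mulDl quotient_mulDr.

Lemma quotient_scaleA a b x :
  quotient_scale a (quotient_scale b x) = quotient_scale (a * b) x.
Proof. by elim/quotient_ind: x => x; rewrite !quotient_piZ scalerA. Qed.

Lemma quotient_scale1 : left_id 1 quotient_scale.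
Proof. by elim/quotient_ind => x; rewrite quotient_piZ scale1r. Qed.

Lemma quotient_scaleDr : right_distributive quotient_scale +%R.
Proof.
move=> c; do 2 elim/quotient_ind => ?.
by rewrite -quotient_piD !quotient_piZ scalerDr quotient_piD.
Qed.

Lemma quotient_scaleDl x : {morph quotient_scale^~ x : a b / a + b}.
Proof.
move=> a b; elim/quotient_ind: x => x.
by rewrite !quotient_piZ scalerDl quotient_piD.
Qed.

HB.instance Definition _ := GRing.Zmodule_isLmodule.Build K Q
  quotient_scaleA quotient_scale1 quotient_scaleDr quotient_scaleDl.

End QuotientAlgebra.

Section Presentation.
Variable K : fieldType.

Definition free_algebra : Type := {malg K[{fmonom generator}]}.
HB.instance Definition _ := GRing.Lalgebra.on free_algebra.

Definition gen_word (g : generator) : free_algebra := << fmu g >>.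

Definition commutator (x y : free_algebra) : free_algebra := x * y - y * x.

Inductive vertex_relation : free_algebra -> Prop :=
| rel_a_adag : vertex_relation (commutator (gen_word Ga) (gen_word Gadag) - 1)
| rel_a_I : vertex_relation (commutator (gen_word Ga) (gen_word GI) - gen_word Ga)
| rel_I_adag :
    vertex_relation (commutator (gen_word GI) (gen_word Gadag) - gen_word Gadag).

Definition presented_algebra : Type := quotient_algebra vertex_relation.
HB.instance Definition _ := GRing.PzRing.on presented_algebra.
HB.instance Definition _ := GRing.Lmodule.on presented_algebra.

Definition presented_gen (g : generator) : presented_algebra :=
  quotient_pi vertex_relation (gen_word g).

End Presentation.

(* Main.v *)
(* The vertex algebra is compared with the free module on triples [(k, l, j)],
   the isomorphism classes of edgeless rules creating [k], preserving [l] and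
   deleting [j] vertices.  The generators act on this module by left
   multiplication, and this action satisfies the three relations.  In the
   presented algebra the elements [adag^k (I)_l a^j], where [(I)_l] is the falling
   factorial [I (I - 1) ... (I - l + 1)], span everything, by commuting a
   generator through them; they send [(0, 0, 0)] to [(k, l, j)], so they are a
   basis.  Falling factorials, rather than powers of [I], appear because in the
   rule algebra the product of the rule [(k, l, j)] with an arbitrary edgeless rule
   [r] is [adag^k (I)_l a^j] applied to [r]: this is proved by enlarging one vertex
   at a time the set of input vertices that a match may use, first through the
   deleted vertices (each contributes [a]), then through the preserved ones (after
   [n] of them the next one contributes [I - n], since [I] also matches the [n]
   output vertices that come from the left rule itself). *)
From HB Require Import structures.
Require Import Defs.
From mathcomp Require Import all_boot all_order all_algebra.
From mathcomp Require Import boolp finmap monalg ring zify.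

Set Implicit Arguments.
Unset Strict Implicit.
Unset Printing Implicit Defensive.

Import GRing.Theory.
Local Open Scope ring_scope.

(** * Linear maps out of free modules *)

Section LinearExtension.
Variables (K : fieldType) (G : choiceType).

Section Extension.
Variables (V : lmodType K) (h : G -> V).

Definition linext (u : {malg K[G]}) : V := \sum_(g <- msupp u) u@_g *: h g.

Lemma linextEw (d : {fset G}) u :
  (msupp u `<=` d)%fset -> linext u = \sum_(g <- d) u@_g *: h g.
Proof.
move=> le_d; rewrite /linext (big_fset_incl _ le_d) //= => g _ /mcoeff_outdom ->.
by rewrite scale0r.
Qed.

Lemma linext_linear : linear linext.
Proof.
move=> c u v; pose d := (msupp u `|` msupp v)%fset.
have le_cuv : (msupp (c *: u + v) `<=` d)%fset.
  apply: fsubset_trans (msuppD_le _ _) _; apply: fsetSU; exact: msuppZ_le.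
rewrite (linextEw le_cuv) (linextEw (fsubsetUl _ _ : msupp u `<=` d)%fset).
rewrite (linextEw (fsubsetUr _ _ : msupp v `<=` d)%fset).
rewrite scaler_sumr -big_split /=; apply: eq_bigr => g _.
by rewrite mcoeffD mcoeffZ scalerDl scalerA.
Qed.

HB.instance Definition _ := GRing.isLinear.Build K {malg K[G]} V _ linext linext_linear.

Lemma linextU g : linext << g >> = h g.
Proof. by rewrite (linextEw msuppU_le) big_seq_fset1 mcoeffUU scale1r. Qed.

End Extension.

Lemma malg_ind (P : {malg K[G]} -> Prop) :
  P 0 -> (forall c g v, P v -> P (c *: << g >> + v)) -> forall u, P u.
Proof.
move=> P0 PD u; rewrite [u]monalgE.
elim: (enum_fset _) => [|g s IHs]; first by rewrite big_nil.
rewrite big_cons (_ : << u@_g *g g >> = u@_g *: << g >>); first exact: PD.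
by apply/malgP => g'; rewrite mcoeffZ !mcoeffU mulrnAr mulr1.
Qed.

Lemma malg_linear_ext (V : lmodType K) (f1 f2 : {linear {malg K[G]} -> V}) :
  (forall g, f1 << g >> = f2 << g >>) -> f1 =1 f2.
Proof.
move=> h; elim/malg_ind => [|c g v IHv]; first by rewrite !linear0.
by rewrite !linearP h IHv.
Qed.

End LinearExtension.

Lemma congrZD (K : fieldType) (V : lmodType K) (c : K) (x x' y y' : V) :
  x = x' -> y = y' -> c *: x + y = c *: x' + y'.
Proof. by move=> -> ->. Qed.

(** Scalars pass the left factor because [K] is commutative; it suffices to check monomials, in [x]
    first and then in [y]. *)
Lemma malg_scalerAr (K : fieldType) (G : monomType) (c : K) (x y : {malg K[G]}) :
  x * (c *: y) = c *: (x * y).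
Proof.
elim/malg_ind: x => [|d g v IHv]; first by rewrite !mul0r scaler0.
rewrite mulrDl [in RHS]mulrDl scalerDr IHv -!scalerAl.
rewrite (scalerA c d) (mulrC c d) -(scalerA d c).
suff -> : << g >> * (c *: y) = c *: (<< g >> * y) by []; clear IHv.
elim/malg_ind: y => [|e g' y IHy]; first by rewrite scaler0 mulr0 scaler0.
have mulU (a : K) : << g >> * (a *: << g' >>) = a *: (<< g >> * << g' >>) :> {malg K[G]}.
  have -> : a *: << g' >> = << a *g g' >> :> {malg K[G]}.
    by apply/malgP => k; rewrite mcoeffZ !mcoeffU mulrnAr mulr1.
  rewrite !malgM_def !fgmulUU !mul1r.
  by apply/malgP => k; rewrite mcoeffZ !mcoeffU mulrnAr mulr1.
by rewrite scalerDr !mulrDr scalerDr IHy scalerA !mulU scalerA.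
Qed.

(** * The presented algebra as a linear quotient of the free algebra *)

Section PresentedAlgebra.
Variable K : fieldType.
Local Notation Q := (presented_algebra K).
Local Notation pi := (quotient_pi (@vertex_relation K)).

Lemma presented_scalerAr (c : K) (x y : Q) : x * (c *: y) = c *: (x * y).
Proof.
elim/quotient_ind: x => x; elim/quotient_ind: y => y.
change (quotient_mul (pi x) (quotient_scale c (pi y)) =
        quotient_scale c (quotient_mul (pi x) (pi y))).
by rewrite !(quotient_piZ, quotient_piM) malg_scalerAr.
Qed.

Lemma pi1 : pi 1 = 1 :> Q. Proof. by []. Qed.

Lemma piM x y : pi (x * y) = pi x * pi y :> Q.
Proof. by rewrite -quotient_piM. Qed.

Lemma pi_linear : linear (pi : free_algebra K -> Q).
Proof.
move=> c x y; change (pi (c *: x + y) = quotient_scale c (pi x) + pi y).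
rewrite quotient_piZ.
exact: (quotient_piD _ (c *: x) y).
Qed.

HB.instance Definition _ :=
  GRing.isLinear.Build K (free_algebra K) Q _ pi pi_linear.

Lemma gen_wordM g (w : {fmonom generator}) :
  gen_word K g * << w >> = << mmul (fmu g) w >> :> free_algebra K.
Proof. by apply: etrans (fgmulUU _ _ _ _) _; rewrite mulr1. Qed.

(** Words grow from the empty one by prepending letters, so closure under left multiplication by
    generators is enough; this is the only kind of multiplication that the normal ordering formulas
    handle. *)
Lemma presented_ind (P : Q -> Prop) :
  P 1 -> (forall c x y, P x -> P y -> P (c *: x + y)) ->
  (forall g x, P x -> P (presented_gen K g * x)) -> forall x, P x.
Proof.
move=> P1 PD PM; elim/quotient_ind => x.
(* No case is given for 0, which is written as -1 times 1 plus 1. *)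
have P0 : P 0 by rewrite -(addNr 1) -scaleN1r; exact: PD.
elim/malg_ind: x => [|c w x IHx]; first by rewrite linear0.
rewrite linearP; apply: PD => // {c x IHx}; case: w => w.
elim: w => [|g w IHw].
  suff -> : << FMonom [::] >> = 1 :> free_algebra K by [].
  by congr (<< _ >>); apply: val_inj; rewrite /= fm1.
move/(PM g): IHw; rewrite /presented_gen -piM gen_wordM.
suff -> : mmul (fmu g) (FMonom w) = FMonom (g :: w) by [].
by apply: val_inj; rewrite /= fmM fmU.
Qed.
End PresentedAlgebra.

(** * Normal ordering *)

Section NormalOrdering.
Variables (R : pzRingType) (ad i a : R).
Hypotheses (a_ad : a * ad = ad * a + 1) (a_i : a * i = i * a + a)
           (i_ad : i * ad = ad * i + ad).

Definition falling (x : R) (n : nat) : R := \prod_(j < n) (x - j%:R).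

Lemma fallingS x n : falling x n.+1 = falling x n * (x - n%:R).
Proof. by rewrite /falling big_ord_recr. Qed.

Lemma falling_comm x n : GRing.comm x (falling x n).
Proof.
apply: commr_prod => j _; apply: commrB; first exact: commr_refl.
exact: commr_nat.
Qed.

Lemma mul_falling x n : x * falling x n = falling x n.+1 + falling x n *+ n.
Proof.
by rewrite falling_comm fallingS mulrBr mulr_natr subrK.
Qed.

(** Moving [a] to the right shifts [i] to [i + 1], and the shifted falling factorial is (i)_n + n
    (i)_(n-1). At [n = 0] the truncated index has coefficient 0. *)
Lemma mul_a_falling n :
  a * falling i n = falling i n * a + falling i n.-1 *+ n * a.
Proof.
elim: n => [|n IHn]; first by rewrite /falling big_ord0 mulr1 mul1r mulr0n mul0r addr0.
have aB (m : nat) : a * (i - m%:R) = (i - m%:R + 1) * a.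
  by rewrite mulrBr a_i !mulrDl mul1r mulNr mulr_natr mulr_natl addrAC.
rewrite fallingS mulrA IHn -mulrDl -mulrA aB mulrA -mulrDl; congr (_ * a).
case: n {IHn} => [|n]; first by rewrite !mulr0n !addr0 subr0 mulrDr mulr1 mulr1n.
(* In one summand the shifted last factor is this [i - n%:R], which extends [falling i n] to
   [falling i n.+1]; in the other it is expanded into the original factor plus 1. *)
have sub1 : i - n.+1%:R + 1 = i - n%:R by rewrite -natr1 opprD addrA subrK.
rewrite mulrDl {2}sub1 mulrDr mulr1 -fallingS mulrnAl -fallingS -addrA.
by rewrite -mulrS.
Qed.

(** Commutation with [a] is the derivation sending [ad] to 1. *)
Lemma mul_a_ad n : a * ad ^+ n = ad ^+ n * a + ad ^+ n.-1 *+ n.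
Proof.
elim: n => [|n IHn]; first by rewrite expr0 mulr1 mul1r addr0.
rewrite [in LHS]exprSr mulrA IHn mulrDl -[_ * a * ad]mulrA a_ad mulrDr mulr1 mulrA.
rewrite -exprSr -addrA; case: n {IHn} => [|n]; first by rewrite mul0r addr0.
by rewrite mulrnAl -exprSr -mulrS.
Qed.

(** Commutation with [i] is the Euler derivation, which multiplies a power of [ad] by its degree. *)
Lemma mul_i_ad n : i * ad ^+ n = ad ^+ n * i + ad ^+ n *+ n.
Proof.
elim: n => [|n IHn]; first by rewrite expr0 mulr1 mul1r addr0.
rewrite [in LHS]exprSr mulrA IHn mulrDl -[_ * i * ad]mulrA i_ad mulrDr mulrA.
by rewrite mulrnAl -!exprSr -addrA -mulrS.
Qed.

Lemma mul_ad_normal k l j :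
  ad * (ad ^+ k * falling i l * a ^+ j) = ad ^+ k.+1 * falling i l * a ^+ j.
Proof. by rewrite !mulrA -exprS. Qed.

Lemma mul_i_normal k l j :
  i * (ad ^+ k * falling i l * a ^+ j) =
  ad ^+ k * falling i l.+1 * a ^+ j + ad ^+ k * falling i l * a ^+ j *+ (k + l).
Proof.
rewrite !mulrA mul_i_ad !mulrDl -(mulrA _ i) mul_falling mulrDr mulrDl -addrA.
by congr (_ + _); rewrite addnC mulrnDr !mulrnAr !mulrnAl.
Qed.

(** Either [a] passes all factors, or it is contracted with one of the [k] factors [ad], or it
    lowers the falling factorial by one of its [l] factors. *)
Lemma mul_a_normal k l j :
  a * (ad ^+ k * falling i l * a ^+ j) =
  ad ^+ k * falling i l * a ^+ j.+1 + ad ^+ k.-1 * falling i l * a ^+ j *+ k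
  + ad ^+ k * falling i l.-1 * a ^+ j.+1 *+ l.
Proof.
rewrite !mulrA mul_a_ad !mulrDl -(mulrA _ a) mul_a_falling mulrDr mulrDl.
by rewrite exprS addrAC !(mulrnAl, mulrnAr) !mulrA.
Qed.
End NormalOrdering.

(** * The action on numbers of created, preserved and deleted vertices *)

Section CountModule.
Variable K : fieldType.
Local Notation Q := (presented_algebra K).
Local Notation pi := (quotient_pi (@vertex_relation K)).

Local Notation M := {malg K[(nat * nat * nat)%type]}.

(* [count_basis k l j] stands for the edgeless rule that creates [k],
   preserves [l] and deletes [j] vertices. *)
Definition count_basis (k l j : nat) : M := << (k, l, j) >>.

(** The coefficients of [mul_ad_normal], [mul_i_normal] and [mul_a_normal]. In terms of rules, the
    input vertex of [GI] or [Ga] is unmatched or meets one of the [k] created or [l] preserved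
    output vertices. [GI] then changes nothing; [Ga] cancels a created vertex and turns a preserved
    one into a deleted one. *)
Definition gen_act_basis (g : generator) (t : nat * nat * nat) : M :=
  let: (k, l, j) := t in
  match g with
  | Gadag => count_basis k.+1 l j
  | GI => count_basis k l.+1 j + count_basis k l j *+ (k + l)
  | Ga => count_basis k l j.+1 + count_basis k.-1 l j *+ k
          + count_basis k l.-1 j.+1 *+ l
  end.

Definition gen_act (g : generator) : M -> M := linext (gen_act_basis g).
HB.instance Definition _ g := GRing.Linear.on (gen_act g).

Lemma gen_actE g k l j :
  gen_act g (count_basis k l j) = gen_act_basis g (k, l, j).
Proof. exact: linextU. Qed.

Definition word_act (w : seq generator) (v : M) : M := foldr gen_act v w.

Lemma word_act_linear w : linear (word_act w).
Proof.
elim: w => [|g w IHw] c u v //.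
by rewrite [LHS](congr1 (gen_act g) (IHw c u v)) linearP.
Qed.

Definition free_act (x : free_algebra K) (v : M) : M :=
  linext (fun w : {fmonom generator} => word_act w v) x.

Lemma free_actP v : linear (free_act^~ v : {malg K[{fmonom generator}]} -> M).
Proof. exact: linext_linear. Qed.

Lemma free_actB (x y : {malg K[{fmonom generator}]}) v :
  free_act (x - y) v = free_act x v - free_act y v.
Proof. exact: (linearB (linext (fun w : {fmonom generator} => word_act w v))). Qed.

Lemma free_act_linear x : linear (free_act x).
Proof.
move=> c u v; elim/malg_ind: x => [|d w x IHx].
  by rewrite /free_act !linear0 addr0.
rewrite !free_actP IHx /free_act !linextU word_act_linear !scalerDr !scalerA.
rewrite (mulrC d c); exact: addrACA.
Qed.

HB.instance Definition _ x :=
  GRing.isLinear.Build K M M _ (free_act x) (free_act_linear x).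

Lemma free_actU (w : {fmonom generator}) v : free_act << w >> v = word_act w v.
Proof. exact: linextU. Qed.

Lemma free_act1 v : free_act 1 v = v.
Proof. by apply: etrans (free_actU _ _) _; rewrite fm1. Qed.

Lemma free_act0 v : free_act 0 v = 0.
Proof. by rewrite /free_act linear0. Qed.

Lemma free_actUM (w w' : {fmonom generator}) v :
  free_act (<< w >> * << w' >>) v = free_act << w >> (free_act << w' >> v).
Proof.
rewrite malgM_def fgmulUU mulr1.
rewrite !free_actU /word_act fmM.
exact: foldr_cat.
Qed.

Lemma free_actM (x y : {malg K[{fmonom generator}]}) v :
  free_act (x * y) v = free_act x (free_act y v).
Proof.
elim/malg_ind: x => [|d w x IHx]; first by rewrite mul0r !free_act0.
rewrite mulrDl -scalerAl !free_actP; apply: congrZD IHx; clear x.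
elim/malg_ind: y => [|e w' y IHy]; first by rewrite mulr0 free_act0 linear0.
rewrite mulrDr malg_scalerAr.
rewrite !free_actP linearP; apply: congrZD IHy; exact: free_actUM.
Qed.

Lemma free_act_gen g v : free_act (gen_word K g) v = gen_act g v.
Proof. by rewrite free_actU fmU. Qed.

Lemma count_ext (V : lmodType K) (f1 f2 : {linear M -> V}) :
  (forall k l j, f1 (count_basis k l j) = f2 (count_basis k l j)) -> f1 =1 f2.
Proof. by move=> h; apply: malg_linear_ext => -[[k l] j]; exact: h. Qed.

Lemma free_act_commutator g h v :
  free_act (commutator (gen_word K g) (gen_word K h)) v =
  gen_act g (gen_act h v) - gen_act h (gen_act g v).
Proof.
have comp g' h' : free_act (gen_word K g' * gen_word K h') v = gen_act g' (gen_act h' v).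
  rewrite (free_actM (gen_word K g') (gen_word K h')).
  by rewrite (free_act_gen h') (free_act_gen g').
by rewrite -(comp g h) -(comp h g); exact: free_actB.
Qed.

(* Hides the basis from [ring], which would unfold it to compare atoms. *)
Lemma coeff_count_basis t :
  exists c : nat -> nat -> nat -> K, forall k l j, (count_basis k l j)@_t = c k l j.
Proof. by eexists. Qed.

(** On a basis triple each of the three relations is a polynomial identity in [k] and [l] between
    coefficients. The case distinctions resolve the truncated predecessors. *)
Lemma gen_act_a_adag v :
  gen_act Ga (gen_act Gadag v) = gen_act Gadag (gen_act Ga v) + v.
Proof.
apply: (count_ext (f1 := gen_act Ga \o gen_act Gadag)
  (f2 := gen_act Gadag \o gen_act Ga \+ idfun)) => k l j /=.
rewrite !(gen_actE, linearD, linearMn) /= !(gen_actE, linearD, linearMn) /=.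
apply/malgP => t; move: (coeff_count_basis t) => [c cE].
move: count_basis cE => b cE; rewrite !(mcoeffD, mcoeffMn, cE).
case: k => [|k] /=; ring.
Qed.

Lemma gen_act_a_I v :
  gen_act Ga (gen_act GI v) = gen_act GI (gen_act Ga v) + gen_act Ga v.
Proof.
apply: (count_ext (f1 := gen_act Ga \o gen_act GI)
  (f2 := gen_act GI \o gen_act Ga \+ gen_act Ga)) => k l j /=.
rewrite !(gen_actE, linearD, linearMn) /= !(gen_actE, linearD, linearMn) /=.
apply/malgP => t; move: (coeff_count_basis t) => [c cE].
move: count_basis cE => b cE; rewrite !(mcoeffD, mcoeffMn, cE).
case: k => [|k]; case: l => [|l] /=; ring.
Qed.

Lemma gen_act_I_adag v :
  gen_act GI (gen_act Gadag v) = gen_act Gadag (gen_act GI v) + gen_act Gadag v.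
Proof.
apply: (count_ext (f1 := gen_act GI \o gen_act Gadag)
  (f2 := gen_act Gadag \o gen_act GI \+ gen_act Gadag)) => k l j /=.
rewrite !(gen_actE, linearD, linearMn) /= !(gen_actE, linearD, linearMn) /=.
apply/malgP => t; move: (coeff_count_basis t) => [c cE].
move: count_basis cE => b cE; rewrite !(mcoeffD, mcoeffMn, cE).
ring.
Qed.

End CountModule.

(** * The normal elements form a basis of the presented algebra *)

Section NormalForm.
Variable K : fieldType.
Local Notation Q := (presented_algebra K).
Local Notation pi := (quotient_pi (@vertex_relation K)).
Local Notation M := {malg K[(nat * nat * nat)%type]}.
Local Notation b := (count_basis K).

(** The elements that annihilate the whole module form a two-sided ideal, which contains the
    relations by the commutation rules of [gen_act]. *)
Lemma free_act_ideal x v : x \in ideal_gen (@vertex_relation K) -> free_act x v = 0.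
Proof.
move=> /asboolP/(_ (fun x => forall v, free_act x v = 0)) h; apply: h => [|s hs {x}v].
  split=> [u|y z hy hz u|y z hz u|y z hy u].
  - exact: free_act0.
  - by rewrite free_actB hy hz subrr.
  - by rewrite (free_actM y z) hz linear0.
  - by rewrite (free_actM z y) hy.
case: hs => {s}; apply/eqP.
- rewrite free_actB free_act_commutator gen_act_a_adag free_act1.
  by rewrite subr_eq0 subr_eq addrC.
- rewrite free_actB free_act_commutator gen_act_a_I free_act_gen.
  by rewrite subr_eq0 subr_eq addrC.
- rewrite free_actB free_act_commutator gen_act_I_adag free_act_gen.
  by rewrite subr_eq0 subr_eq addrC.
Qed.

Definition vertex_act (x : Q) : M -> M := free_act (repr x).

HB.instance Definition _ x := GRing.Linear.on (vertex_act x).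

(** Two representatives differ by an element of the ideal, which acts as 0, so the choice made in
    [vertex_act] is immaterial. *)
Lemma vertex_act_pi x v : vertex_act (pi x) v = free_act x v.
Proof.
apply/eqP; rewrite -subr_eq0 -free_actB; apply/eqP/free_act_ideal.
exact: quotient_reprP.
Qed.

Lemma vertex_act_linear v : linear (vertex_act^~ v).
Proof.
move=> c; elim/quotient_ind => x; elim/quotient_ind => y.
rewrite -pi_linear !vertex_act_pi; exact: free_actP.
Qed.

Lemma vertex_actM x y v : vertex_act (x * y) v = vertex_act x (vertex_act y v).
Proof.
elim/quotient_ind: x => x; elim/quotient_ind: y => y.
rewrite -piM !vertex_act_pi; exact: free_actM.
Qed.

Lemma vertex_act1 v : vertex_act 1 v = v.
Proof. by rewrite -pi1 vertex_act_pi; exact: free_act1. Qed.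

Lemma vertex_act_gen g v : vertex_act (presented_gen K g) v = gen_act g v.
Proof. by rewrite vertex_act_pi free_act_gen. Qed.

Lemma vertex_actX x n v : vertex_act (x ^+ n) v = iter n (vertex_act x) v.
Proof.
elim: n => [|n IHn]; first by rewrite expr0 vertex_act1.
by rewrite exprS vertex_actM IHn.
Qed.

Let adag := presented_gen K Gadag.
Let i := presented_gen K GI.
Let a := presented_gen K Ga.

Let pi_rel x : vertex_relation x -> pi x = 0.
Proof.
move=> hx; rewrite -(linear0 pi); apply/quotient_piP; rewrite subr0.
by apply/asboolP => J _; exact.
Qed.

(* Proof terms instead of [rewrite], which would unfold the product of
   [free_algebra K] when comparing [x * y] with [y * x]. *)
Lemma pi_commutator x y : pi (commutator x y) = pi x * pi y - pi y * pi x :> Q.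
Proof.
exact: etrans (linearB pi _ _) (congr2 (fun u v : Q => u - v) (piM x y) (piM y x)).
Qed.

Lemma presented_commutator g h z :
  vertex_relation (commutator (gen_word K g) (gen_word K h) - z) ->
  presented_gen K g * presented_gen K h =
  presented_gen K h * presented_gen K g + pi z.
Proof.
move=> /pi_rel E; have /eqP := etrans (esym (congr2 (fun u v : Q => u - v)
  (pi_commutator _ _) (erefl (pi z)))) (etrans (esym (linearB pi _ _)) E).
by rewrite subr_eq0 subr_eq addrC => /eqP.
Qed.

Let a_adag : a * adag = adag * a + 1 := presented_commutator (rel_a_adag K).
Let a_i : a * i = i * a + a := presented_commutator (rel_a_I K).
Let i_adag : i * adag = adag * i + adag := presented_commutator (rel_I_adag K).

Definition normal_elt (k l j : nat) : Q :=
  presented_gen K Gadag ^+ k * falling (presented_gen K GI) l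
  * presented_gen K Ga ^+ j.

Definition normal_map : M -> Q :=
  linext (fun t : nat * nat * nat => normal_elt t.1.1 t.1.2 t.2).
HB.instance Definition _ := GRing.Linear.on normal_map.

Lemma normal_mapE k l j : normal_map (b k l j) = normal_elt k l j.
Proof. exact: linextU. Qed.

Definition gen_mul (g : generator) (x : Q) : Q := presented_gen K g * x.

Lemma gen_mul_linear g : linear (gen_mul g).
Proof.
move=> c x y; rewrite /gen_mul -presented_scalerAr; exact: mulrDr.
Qed.
HB.instance Definition _ g :=
  GRing.isLinear.Build K Q Q _ (gen_mul g) (gen_mul_linear g).

(** On basis triples this is the reordering formula from which the coefficients of [gen_act] are
    taken. *)
Lemma normal_map_gen_act g v :
  normal_map (gen_act g v) = presented_gen K g * normal_map v.
Proof.
apply: (count_ext (f1 := normal_map \o gen_act g) (f2 := gen_mul g \o normal_map)).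
move=> k l j /=; rewrite gen_actE normal_mapE /gen_mul.
case: g => /=.
- by rewrite normal_mapE /normal_elt mul_ad_normal.
- rewrite linearD linearMn /= !normal_mapE /normal_elt.
  by rewrite (mul_i_normal _ i_adag).
- rewrite !linearD !linearMn /= !normal_mapE /normal_elt.
  by rewrite (mul_a_normal a_adag a_i).
Qed.

(** The image is a subspace that contains 1 and, by [normal_map_gen_act], is stable under left
    multiplication by generators. *)
Lemma normal_map_surj x : exists u, normal_map u = x.
Proof.
elim/presented_ind: x => [|c x y [u <-] [v <-]|g x [u <-]].
- by exists (b 0 0 0); rewrite normal_mapE /normal_elt /falling big_ord0 !mulr1.
- by exists (c *: u + v); rewrite linearP.
- by exists (gen_act g u); exact: normal_map_gen_act.
Qed.

Fixpoint falling_act (n : nat) (v : M) : M :=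
  if n is n'.+1 then gen_act GI (falling_act n' v) - falling_act n' v *+ n' else v.

Definition normal_act (k l j : nat) (v : M) : M :=
  iter k (gen_act Gadag) (falling_act l (iter j (gen_act Ga) v)).

Lemma vertex_act_falling n v :
  vertex_act (falling (presented_gen K GI) n) v = falling_act n v.
Proof.
elim: n => [|n IHn]; first by rewrite /falling big_ord0 vertex_act1.
have -> : falling (presented_gen K GI) n.+1 =
    presented_gen K GI * falling (presented_gen K GI) n
    - falling (presented_gen K GI) n *+ n by rewrite mul_falling addrK.
have B x y : vertex_act (x - y) v = vertex_act x v - vertex_act y v.
  by rewrite -scaleN1r addrC vertex_act_linear scaleN1r addrC.
have Mn x m : vertex_act (x *+ m) v = vertex_act x v *+ m.
  (* Linearity is available for [c *: x + y] only, so it is used with [y = 0]; that 0 acts as 0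
     follows from [B] and 0 = 0 - 0. *)
  rewrite -scaler_nat -[_ *: x]addr0 vertex_act_linear -(subrr 0) B subrr addr0.
  exact: scaler_nat.
by rewrite B Mn vertex_actM vertex_act_gen IHn.
Qed.

Lemma vertex_act_normal k l j v : vertex_act (normal_elt k l j) v = normal_act k l j v.
Proof.
rewrite /normal_elt !vertex_actM !vertex_actX vertex_act_falling /normal_act.
rewrite (eq_iter (vertex_act_gen Ga)).
exact: (eq_iter (vertex_act_gen Gadag)).
Qed.

Lemma normal_act_basis k l j : normal_act k l j (b 0 0 0) = b k l j.
Proof.
rewrite /normal_act; have -> : iter j (gen_act Ga) (b 0 0 0) = b 0 0 j.
  by elim: j => [//|j IHj]; rewrite iterS IHj gen_actE /= !mulr0n !addr0.
(* With no created vertex, [gen_act GI] returns the old triple with multiplicity [l], which is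
   exactly what [falling_act] subtracts. *)
have falling_b : falling_act l (b 0 0 j) = b 0 l j.
  by elim: l => [//|l IHl]; rewrite [LHS]/= IHl gen_actE /= addrK.
by rewrite falling_b; elim: k => [//|k IHk]; rewrite iterS IHk gen_actE.
Qed.

(** Coordinates with respect to the normal elements, obtained by acting on the triple of the empty
    rule. *)
Definition counts (x : Q) : M := vertex_act x (b 0 0 0).

Lemma counts_linear : linear counts.
Proof. exact: vertex_act_linear. Qed.
HB.instance Definition _ := GRing.isLinear.Build K Q M _ counts counts_linear.

(** This gives the linear independence of the normal elements; that they span is
    [normal_map_surj]. *)
Lemma normal_mapK : cancel normal_map counts.
Proof.
move=> u; apply: (count_ext (f1 := counts \o normal_map) (f2 := idfun)) => k l j /=.
by rewrite normal_mapE /counts vertex_act_normal normal_act_basis.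
Qed.

Lemma countsK : cancel counts normal_map.
Proof. by move=> x; have [u <-] := normal_map_surj x; rewrite normal_mapK. Qed.

Lemma counts1 : counts 1 = b 0 0 0.
Proof. exact: vertex_act1. Qed.

Lemma countsM x y : counts (x * y) = vertex_act x (counts y).
Proof. exact: vertex_actM. Qed.

Lemma counts_gen g : counts (presented_gen K g) =
  match g with Gadag => b 1 0 0 | GI => b 0 1 0 | Ga => b 0 0 1 end.
Proof.
by rewrite /counts vertex_act_gen gen_actE; case: g; rewrite /= ?mulr0n ?addr0.
Qed.

End NormalForm.

(** * Sums over matches *)

Lemma sum_bool_card (A : finType) (s : {set A}) (Q : pred A) :
  (\sum_(x in s) Q x)%N = #|[set x in s | Q x]|.
Proof.
by rewrite -sum1dep_card [RHS]big_mkcondr /=; apply: eq_bigr => x _; case: (Q x).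
Qed.

Section OneToOne.
Variables (A B : finType).
Implicit Types r s : {set A * B}.

Lemma one_to_oneS s r : s \subset r -> one_to_one r -> one_to_one s.
Proof.
move=> /subsetP srs /one_to_oneP[hl hr]; apply/one_to_oneP; split=> ? ? ? /srs h /srs.
  exact: hl.
exact: hr.
Qed.

Lemma fst_inj r : one_to_one r -> {in r &, injective fst}.
Proof.
by move=> /one_to_oneP[hl _] [x y] [x' y'] h h' /= e; subst x'; rewrite (hl _ _ _ h h').
Qed.

Lemma snd_inj r : one_to_one r -> {in r &, injective snd}.
Proof.
by move=> /one_to_oneP[_ hr] [x y] [x' y'] h h' /= e; subst y'; rewrite (hr _ _ _ h h').
Qed.

Lemma card_rel_dom r : one_to_one r -> #|rel_dom r| = #|r|.
Proof. by move=> h; rewrite card_in_imset //; exact: fst_inj. Qed.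

Lemma card_rel_im r : one_to_one r -> #|rel_im r| = #|r|.
Proof. by move=> h; rewrite card_in_imset //; exact: snd_inj. Qed.

Lemma mem_rel_dom r x y : (x, y) \in r -> x \in rel_dom r.
Proof. by move=> h; apply/imsetP; exists (x, y). Qed.

Lemma mem_rel_im r x y : (x, y) \in r -> y \in rel_im r.
Proof. by move=> h; apply/imsetP; exists (x, y). Qed.

Lemma rel_domP r x : reflect (exists y, (x, y) \in r) (x \in rel_dom r).
Proof.
apply: (iffP imsetP) => [[[x' y] h /= ->]|[y h]]; first by exists y.
by exists (x, y).
Qed.

Lemma rel_imP r y : reflect (exists x, (x, y) \in r) (y \in rel_im r).
Proof.
apply: (iffP imsetP) => [[[x y'] h /= ->]|[x h]]; first by exists x.
by exists (x, y).
Qed.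

Lemma rel_domU1 r p : rel_dom (p |: r) = p.1 |: rel_dom r.
Proof. by rewrite /rel_dom imsetU1. Qed.

Lemma rel_imU1 r p : rel_im (p |: r) = p.2 |: rel_im r.
Proof. by rewrite /rel_im imsetU1. Qed.

Lemma one_to_oneU1 r p : p.1 \notin rel_dom r -> p.2 \notin rel_im r ->
  one_to_one (p |: r) = one_to_one r.
Proof.
case: p => x y /= nx ny; apply/idP/idP; first by apply: one_to_oneS; exact: subsetUr.
move=> /one_to_oneP[hl hr]; apply/one_to_oneP.
split=> [u v v'|u u' v]; rewrite !inE !xpair_eqE.
- case/orP => [/andP[/eqP -> /eqP ->]|h].
    by case/orP => [/andP[_ /eqP ->]|/mem_rel_dom h] //; rewrite h in nx.
  case/orP => [/andP[/eqP eu _]|]; last exact: hl h.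
  by move: h; rewrite eu => /mem_rel_dom h; rewrite h in nx.
- case/orP => [/andP[/eqP -> /eqP ->]|h].
    by case/orP => [/andP[/eqP -> _]|/mem_rel_im h] //; rewrite h in ny.
  case/orP => [/andP[_ /eqP ev]|]; last exact: hr h.
  by move: h; rewrite ev => /mem_rel_im h; rewrite h in ny.
Qed.
End OneToOne.

(** * Matchings whose image lies in a given set, one input vertex at a time *)

Section Matchings.
Variables (O I : finType) (V : zmodType).

Definition matchings (D : {set I}) : {set {set O * I}} :=
  [set m | one_to_one m & rel_im m \subset D].

Lemma matchings0 : matchings set0 = [set set0].
Proof.
apply/setP => m; rewrite !inE; apply/andP/eqP => [[_]|->].
  rewrite subset0 => /eqP h; apply/setP => -[y x]; rewrite inE.
  by apply/negP => /mem_rel_im; rewrite h inE.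
by split; [exact: set0_one_to_one|rewrite /rel_im imset0 sub0set].
Qed.

(** A matching into [x |: D] either misses [x] or arises from a unique matching into [D] by joining
    [x] to a free [y]. *)
Lemma sum_matchingsU1 (D : {set I}) (x : I) (G : {set O * I} -> V) :
  x \notin D ->
  \sum_(m in matchings (x |: D)) G m =
  \sum_(m in matchings D) (G m + \sum_(y in ~: rel_dom m) G ((y, x) |: m)).
Proof.
move=> nx; rewrite (bigID (fun m => x \in rel_im m)) /= addrC big_split /=; congr (_ + _).
  apply: eq_bigl => m; rewrite !inE -andbA; congr (_ && _).
  apply/andP/idP => [[/subsetP h nxm]|h].
    apply/subsetP => z zm; have := h z zm; rewrite !inE => /orP[/eqP ez|//].
    by rewrite -ez zm in nxm.
  split; first exact: subset_trans h (subsetUr _ _).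
  by apply: contra nx; exact: (subsetP h).
(* The inner sum has one term, for the partner [y] of [x]; it lets the matchings be grouped by that
   partner. *)
transitivity (\sum_(m in matchings (x |: D) | x \in rel_im m)
    \sum_(y | (y, x) \in m) G m).
  apply: eq_bigr => m /andP[]; rewrite inE => /andP[h _] /rel_imP[y hy].
  rewrite (big_pred1 y) // => z; apply/idP/eqP => [|-> //].
  by have /one_to_oneP[_ hr] := h; move=> hz; exact: hr hz hy.
rewrite (exchange_big_dep predT) //= [RHS](exchange_big_dep predT) //=.
apply: eq_bigr => y _.
(* For fixed [y], inserting and removing the pair are inverse to each other. *)
rewrite (reindex_onto (fun m => (y, x) |: m) (fun m => m :\ (y, x))) /=; last first.
  by move=> m /andP[_ h]; exact: setD1K.
apply: eq_bigl => m; rewrite setU11 !inE !rel_imU1 setU11 !andbT; apply/andP/andP.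
  move=> [/andP[h1 hs] /eqP hm].
  have nm : (y, x) \notin m by rewrite -hm !inE eqxx.
  have /one_to_oneP[hl hr] := h1.
  have nym : y \notin rel_dom m.
    apply/negP => /rel_domP[z hz]; have /= e : z = x.
      by apply: hl; [apply: setU1r; exact: hz|exact: setU11].
    by rewrite -e hz in nm.
  have nxm : x \notin rel_im m.
    apply/negP => /rel_imP[z hz]; have /= e : z = y.
      by apply: hr; [apply: setU1r; exact: hz|exact: setU11].
    by rewrite -e hz in nm.
  split=> //; rewrite -(one_to_oneU1 (p := (y, x))) // h1 /=.
  apply/subsetP => z hz; have := subsetP hs z (setU1r _ hz); rewrite !inE.
  by case/orP => // /eqP e; rewrite -e hz in nxm.
move=> [/andP[h hs] ny].
have nxm : x \notin rel_im m by apply: contra nx; exact: (subsetP hs).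
rewrite one_to_oneU1 // h setUS //=; split=> //; apply/eqP/setU1K.
by apply: contra ny; exact: mem_rel_dom.
Qed.
End Matchings.

Lemma finset_ind (A : finType) (Q : {set A} -> Prop) :
  Q set0 -> (forall x (D : {set A}), x \notin D -> Q D -> Q (x |: D)) -> forall D, Q D.
Proof.
move=> Q0 QU D; have [n] := ubnP #|D|; elim: n D => // n IHn D ltDn.
have [->//|[x xD]] := set_0Vmem D; rewrite -(setD1K xD).
by apply: QU; [rewrite !inE eqxx|apply: IHn; move: ltDn; rewrite (cardsD1 x) xD].
Qed.

(** * Summing the composites over all matches *)

Section MatchSums.
Variables (K : fieldType) (O I : finType).
(* [P] are the vertices of [I] preserved by the left rule, [C] those of [O]
   preserved by the right rule, which deletes [j0] further vertices.  The left rule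
   is restricted to its input vertices in [D]. *)
Variables (P : {set I}) (C : {set O}) (j0 : nat).
Local Notation M := {malg K[(nat * nat * nat)%type]}.
Local Notation b := (count_basis K).
Implicit Types (D : {set I}) (m : {set O * I}).

(** Unmatched vertices keep their kind. A matched pair is preserved if both rules preserve it,
    created if only the left one does, deleted if only the right one does, and otherwise disappears.
    Vertices created by the left rule are added in [match_sumE]. *)
Definition comp_created m : nat :=
  \sum_(p in m) ((p.2 \in P) && (p.1 \notin C)) + \sum_(y in ~: rel_dom m) (y \notin C).
Definition comp_preserved D m : nat :=
  \sum_(p in m) ((p.2 \in P) && (p.1 \in C)) + \sum_(x in D :\: rel_im m) (x \in P)
  + \sum_(y in ~: rel_dom m) (y \in C).
Definition comp_deleted D m : nat :=
  j0 + \sum_(x in D :\: rel_im m) (x \notin P)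
  + \sum_(p in m) ((p.2 \notin P) && (p.1 \in C)).

Definition comp_basis D m : M :=
  b (comp_created m) (comp_preserved D m) (comp_deleted D m).

Definition match_sum D : M := \sum_(m in matchings O D) comp_basis D m.

Section Step.
Variables (D : {set I}) (x : I) (m : {set O * I}).
Hypotheses (nx : x \notin D) (mD : m \in matchings O D).

Let nxm : x \notin rel_im m.
Proof. by move: mD; rewrite inE => /andP[_ /subsetP h]; apply: contra nx; exact: h. Qed.

Let setDU1 : (x |: D) :\: rel_im m = x |: D :\: rel_im m.
Proof.
apply/setP => z; rewrite !inE; case: eqVneq => [->|] //=.
by rewrite nxm.
Qed.

Let nxDm : x \notin D :\: rel_im m. Proof. by rewrite inE negb_and nx orbT. Qed.

Lemma comp_basis_skip : comp_basis (x |: D) m =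
  b (comp_created m) (comp_preserved D m + (x \in P)) (comp_deleted D m + (x \notin P)).
Proof.
rewrite /comp_basis /comp_preserved /comp_deleted setDU1 !big_setU1 //=.
by congr b; lia.
Qed.

(** The new pair withdraws [y] from the free vertices and contributes according to its kind. The
    withdrawn terms are added on the left, which avoids truncated subtraction. *)
Lemma comp_basis_match y : y \notin rel_dom m ->
  let m' := (y, x) |: m in
  [/\ (comp_created m' + (y \notin C) = comp_created m + ((x \in P) && (y \notin C)))%N,
      (comp_preserved (x |: D) m' + (y \in C) =
       comp_preserved D m + ((x \in P) && (y \in C)))%N &
      (comp_deleted (x |: D) m' = comp_deleted D m + ((x \notin P) && (y \in C)))%N].
Proof.
move=> ny m'.
have nm : (y, x) \notin m by apply: contra ny; exact: mem_rel_dom.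
have Dm : (x |: D) :\: rel_im m' = D :\: rel_im m.
  apply/setP => z; rewrite rel_imU1 !inE /=; case: eqVneq => [->|] //=.
  by rewrite (negPf nx) andbF.
have sum_dom (f : O -> bool) :
  (\sum_(z in ~: rel_dom m) f z = f y + \sum_(z in ~: rel_dom m') f z)%N.
  rewrite (big_setD1 y) ?inE //=; congr (_ + _)%N; apply: eq_bigl => z.
  by rewrite rel_domU1 !inE negb_or.
rewrite /comp_created /comp_preserved /comp_deleted Dm !sum_dom !big_setU1 //=.
by split; lia.
Qed.
End Step.

Lemma match_sum0 : match_sum set0 = b #|~: C| #|C| j0.
Proof.
rewrite /match_sum matchings0 big_set1 /comp_basis /comp_created /comp_preserved.
rewrite /comp_deleted !set0D !big_set0 /rel_dom imset0 setC0 addn0 !add0n.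
have -> : (\sum_(y in [set: O]) (y \notin C) = #|~: C|)%N.
  by rewrite sum_bool_card; apply: eq_card => z; rewrite !inE.
have -> : (\sum_(y in [set: O]) (y \in C) = #|C|)%N; last by rewrite !addn0.
by rewrite sum_bool_card; apply: eq_card => z; rewrite !inE.
Qed.

(** Leaving [x] unmatched gives the first term of [gen_act Ga]; joining it to a free [y] gives the
    second if [y] is created by the right rule and the third if [y] is preserved. *)
Lemma match_sum_deleted D x : [disjoint D & P] -> x \notin D -> x \notin P ->
  match_sum (x |: D) = gen_act Ga (match_sum D).
Proof.
move=> dP nx nP; rewrite /match_sum sum_matchingsU1 // linear_sum /=.
apply: eq_bigr => m mD; rewrite (comp_basis_skip nx mD) nP (negPf nP) addn0 addn1.
rewrite [comp_basis D m]/comp_basis gen_actE /= -addrA; congr (_ + _).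
(* As [D] avoids [P], the vertices created and preserved so far are exactly the free vertices of
   [O], so the multiplicities in [gen_act Ga] become sums over free [y]. This is why the deleted
   vertices are treated first. *)
have mP p : p \in m -> (p.2 \in P) = false.
  move: mD; rewrite inE => /andP[_ /subsetP h] pm.
  by apply: (disjointFr dP); apply: h; apply/imsetP; exists p.
have kE : comp_created m = (\sum_(y in ~: rel_dom m) (y \notin C))%N.
  by rewrite /comp_created big1 // => p /mP ->.
have lE : comp_preserved D m = (\sum_(y in ~: rel_dom m) (y \in C))%N.
  rewrite /comp_preserved big1 => [|p /mP -> //].
  by rewrite big1 // => z; rewrite inE => /andP[_ /(disjointFr dP) ->].
rewrite {2}kE {3}lE -!sumrMnr -big_split /=; apply: eq_bigr => y.
rewrite inE => ny; have [] := comp_basis_match nx mD ny.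
rewrite /comp_basis (negPf nP) /= !addn0.
by case: (y \in C) => /= e1 e2 e3; rewrite ?mulr0n ?mulr1n ?addr0 ?add0r; congr b; lia.
Qed.

(** An unmatched [x] is one more preserved vertex, while joining [x] to a free [y] leaves the triple
    unchanged. Hence the second term should carry the number of free [y] instead of the multiplicity
    in [gen_act GI]. *)
Lemma match_sum_preserved D x : x \notin D -> x \in P ->
  match_sum (x |: D) = gen_act GI (match_sum D) - match_sum D *+ #|D :&: P|.
Proof.
move=> nx xP; rewrite /match_sum sum_matchingsU1 // linear_sum -sumrMnl -sumrB /=.
apply: eq_bigr => m mD; rewrite (comp_basis_skip nx mD) xP addn0 addn1.
rewrite [comp_basis D m]/comp_basis gen_actE /= -addrA; congr (_ + _).
(* Each output vertex counted so far is a free vertex of [O] or belongs to one vertex of [D :&: P],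
   matched or not; the latter are the excess to be subtracted. *)
have cE : (comp_created m + comp_preserved D m = #|~: rel_dom m| + #|D :&: P|)%N.
  have -> : #|D :&: P| = (\sum_(z in D) (z \in P))%N.
    by rewrite sum_bool_card; apply: eq_card => z; rewrite !inE.
  have [hm /setIidPr hs] : one_to_one m /\ rel_im m \subset D.
    by move: mD; rewrite inE => /andP.
  rewrite (big_setID (rel_im m)) /= hs big_imset /=; last exact: snd_inj.
  have -> : #|~: rel_dom m| = (\sum_(y in ~: rel_dom m) ((y \in C) + (y \notin C)))%N.
    by rewrite -sum1_card; apply: eq_bigr => y _; case: (y \in C).
  have -> : (\sum_(p in m) (p.2 \in P) = \sum_(p in m) ((p.2 \in P) && (p.1 \in C))
      + \sum_(p in m) ((p.2 \in P) && (p.1 \notin C)))%N.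
    by rewrite -big_split; apply: eq_bigr => p _; case: (p.2 \in P); case: (p.1 \in C).
  by rewrite big_split /comp_created /comp_preserved /=; lia.
rewrite cE mulrnDr addrK -sumr_const; apply: eq_bigr => y.
rewrite inE => ny; have [] := comp_basis_match nx mD ny.
rewrite /comp_basis xP /= addn0 => e1 e2 ->; congr b; lia.
Qed.

Lemma match_sum_disjoint D : [disjoint D & P] ->
  match_sum D = iter #|D| (gen_act Ga) (b #|~: C| #|C| j0).
Proof.
elim/finset_ind: D => [|x D nx IHD]; first by rewrite match_sum0 cards0.
rewrite disjoints_subset subUset sub1set inE -disjoints_subset => /andP[nP dP].
by rewrite match_sum_deleted // IHD // cardsU1 nx.
Qed.

Lemma match_sum_setU D : D \subset P ->
  match_sum (D :|: ~: P) = falling_act #|D| (match_sum (~: P)).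
Proof.
elim/finset_ind: D => [|x D nx IHD]; first by rewrite set0U cards0.
rewrite subUset sub1set => /andP[xP DP].
rewrite -setUA match_sum_preserved //; last by rewrite !inE negb_or nx negbK.
(* Only preserved vertices count in the correction, so it is [#|D|], as [falling_act] requires. *)
have -> : (D :|: ~: P) :&: P = D.
  by rewrite setIUl setIC (setIidPr DP) setIC setICr setU0.
by rewrite IHD // cardsU1 nx.
Qed.

Lemma match_sum_setT k : iter k (gen_act Gadag) (match_sum setT) =
  normal_act k #|P| #|~: P| (b #|~: C| #|C| j0).
Proof.
rewrite /normal_act -match_sum_disjoint; last by rewrite disjoints_subset.
by rewrite -match_sum_setU // setUCr.
Qed.

Lemma iter_adag k v : iter k (gen_act Gadag) v =
  linext (fun t : nat * nat * nat => b (k + t.1.1) t.1.2 t.2) v.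
Proof.
elim: k v => [|k IHk] v.
  apply: (count_ext (f1 := idfun) (f2 := linext _)) => k l j.
  exact/esym/linextU.
rewrite iterS IHk; apply: (count_ext (f1 := gen_act Gadag \o linext _) (f2 := linext _)).
move=> k' l j; apply: etrans (congr1 (gen_act Gadag) (linextU _ _)) _.
by apply: etrans (gen_actE _ _ _ _ _) _; exact/esym/linextU.
Qed.

(** The [k] vertices created by the left rule take part in no match and only shift the first index,
    by [iter_adag]. *)
Lemma match_sumE k : \sum_(m | one_to_one m)
    b (k + comp_created m) (comp_preserved setT m) (comp_deleted setT m) =
  normal_act k #|P| #|~: P| (b #|~: C| #|C| j0).
Proof.
rewrite -match_sum_setT iter_adag linear_sum /=.
apply: eq_big => [m|m _]; first by rewrite inE subsetT andbT.
by rewrite /comp_basis [RHS]linextU.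
Qed.
End MatchSums.

(** * Edgeless rules and their composites *)

Section Standard.
Variables k l j : nat.

Definition std_rel : {set ('I_l + 'I_j) * ('I_l + 'I_k)} :=
  [set (inl i, inl i) | i : 'I_l].

Lemma std_rel_one_to_one : one_to_one std_rel.
Proof.
apply/one_to_oneP; split=> ? ? ? /imsetP[i _ [-> ->]] /imsetP[i' _ [e e']];
  by rewrite ?e ?e'; congr inl; case: e e' => // -> [].
Qed.

Lemma card_std_rel : #|std_rel| = l.
Proof. by rewrite card_imset ?card_ord // => i i' []. Qed.

Definition std_rule : rule ('I_l + 'I_j)%type void ('I_l + 'I_k)%type void :=
  Rule (edgeless_pmor (Graph (of_void _) (of_void _)) (Graph (of_void _) (of_void _))
    std_rel_one_to_one).

Definition std_class : rule_class := class_of std_rule.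
End Standard.

Section Invariants.
Variables (VI EI VO EO VI' EI' VO' EO' : finType).
Variables (r : rule VI EI VO EO) (r' : rule VI' EI' VO' EO').
Hypothesis rr' : rule_iso r r'.

Lemma rule_iso_card :
  [/\ #|VI| = #|VI'|, #|VO| = #|VO'| & #|(rule_rel r).1| = #|(rule_rel r').1|].
Proof.
have [fV [fE [gV [gE [[bfV _ _ _] [bgV _ _ _] hV _]]]]] := rr'.
have [fV' kfV kfV'] := bfV; have [gV' kgV kgV'] := bgV.
split; [exact: bij_eq_card bfV|exact: bij_eq_card bgV|].
rewrite -(card_imset (mem (rule_rel r).1) (f := fun p => (fV p.1, gV p.2))); last first.
  by move=> [x y] [x' y'] [/(can_inj kfV) -> /(can_inj kgV) ->].
apply: eq_card => -[x y]; apply/imsetP/idP => [[[u v] h [-> ->]]|h].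
  by rewrite hV.
by exists (fV' x, gV' y); rewrite /= ?kfV' ?kgV' // -hV kfV' kgV'.
Qed.

Lemma rule_iso_edgeless :
  ((EI' -> False) -> EI -> False) * ((EO' -> False) -> EO -> False).
Proof.
have [fV [fE [gV [gE _]]]] := rr'.
by split=> h e; apply: h; [exact: fE|exact: gE].
Qed.
End Invariants.

Lemma std_class_inj k l j k' l' j' :
  std_class k l j = std_class k' l' j' -> (k, l, j) = (k', l', j').
Proof.
move/class_of_eq/rule_iso_card => [].
rewrite !card_std_rel !card_sum !card_ord => eI eO el; subst l'.
by move: eI eO => /addnI -> /addnI ->.
Qed.

(** The three numbers determine an edgeless rule up to isomorphism: the pairs of the relation are
    numbered first, then the unrelated vertices on each side. *)
Lemma class_of_edgeless (VI EI VO EO : finType) (r : rule VI EI VO EO) k l j :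
  (EI -> False) -> (EO -> False) ->
  #|(rule_rel r).1| = l -> #|VI| = (l + j)%N -> #|VO| = (l + k)%N ->
  class_of r = std_class k l j.
Proof.
move=> nI nO el eI eO; subst l; apply/class_of_eq/rule_iso_sym.
set R := (rule_rel r).1 in eI eO *.
have oR : one_to_one R by have /and3P[] := rule_relP r.
have cI : #|~: rel_dom R| = j by rewrite cardsCs setCK card_rel_dom // eI addKn.
have cO : #|~: rel_im R| = k by rewrite cardsCs setCK card_rel_im // eO addKn.
subst j k.
(* [f] and [g] use the same enumeration of the pairs of [R], so that the standard pairs go to pairs
   of [R]. *)
pose f (u : 'I_#|R| + 'I_#|~: rel_dom R|) : VI :=
  match u with inl i => (enum_val i).1 | inr i => enum_val i end.
pose g (u : 'I_#|R| + 'I_#|~: rel_im R|) : VO :=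
  match u with inl i => (enum_val i).2 | inr i => enum_val i end.
have fP i : f (inl i) \in rel_dom R by apply: imset_f; exact: enum_valP.
have gP i : g (inl i) \in rel_im R by apply: imset_f; exact: enum_valP.
have fN i : f (inr i) \notin rel_dom R by have := enum_valP i; rewrite inE.
have gN i : g (inr i) \notin rel_im R by have := enum_valP i; rewrite inE.
have f_inj : injective f.
  move=> [i|i] [i'|i'] e.
  - by congr inl; apply: enum_val_inj; apply: (fst_inj oR) => //; exact: enum_valP.
  - by have := fP i; rewrite e (negPf (fN i')).
  - by have := fN i; rewrite e fP.
  - by congr inr; apply: enum_val_inj.
have g_inj : injective g.
  move=> [i|i] [i'|i'] e.
  - by congr inl; apply: enum_val_inj; apply: (snd_inj oR) => //; exact: enum_valP.
  - by have := gP i; rewrite e (negPf (gN i')).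
  - by have := gN i; rewrite e gP.
  - by congr inr; apply: enum_val_inj.
have bf : bijective f by apply: inj_card_bij => //; rewrite card_sum !card_ord eI.
have bg : bijective g by apply: inj_card_bij => //; rewrite card_sum !card_ord eO.
have bv (E : finType) : (E -> False) -> bijective (of_void E).
  by move=> nE; exists (fun e => match nE e with end) => [[]|e]; case: (nE e).
exists f, (of_void EI), g, (of_void EO); split.
- by split=> //; exact: bv.
- by split=> //; exact: bv.
- move=> u v; apply/idP/imsetP => [h|[i _ [-> ->]]]; last first.
    by rewrite /= -surjective_pairing; exact: enum_valP.
  case: u h => [i|i] h; last by move: (mem_rel_dom h); rewrite (negPf (fN i)).
  case: v h => [i'|i'] h; last by move: (mem_rel_im h); rewrite (negPf (gN i')).
  exists i => //; congr (_, inl _); apply: enum_val_inj.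
  apply: (fst_inj oR); try exact: enum_valP.
  have /one_to_oneP[_ hr] := oR; apply: (hr _ _ _ _ h).
  by rewrite /= -surjective_pairing; exact: enum_valP.
- by case.
Qed.

(** * Cardinals of the interfaces and of the relation of a composite *)

Section CompositeRelation.
Variables (I1 O1 I2 O2 : finType).
Variables (r1 : {set I1 * O1}) (m : {set O2 * I1}) (r2 : {set I2 * O2}).
Hypotheses (o1 : one_to_one r1) (om : one_to_one m) (o2 : one_to_one r2).
Let P := rel_dom r1.
Let C := rel_im r2.

Lemma card_comp_I : #|comp_I I2 m| = (#|I2| + #|~: rel_im m|)%N.
Proof.
by rewrite /comp_I card_sum card_sig; congr (_ + _)%N; apply: eq_card => x; rewrite !inE.
Qed.

Lemma card_comp_O : #|comp_O O1 m| = (#|O1| + #|~: rel_dom m|)%N.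
Proof.
by rewrite /comp_O card_sum card_sig; congr (_ + _)%N; apply: eq_card => x; rewrite !inE.
Qed.

Lemma card_set_sum (A B : finType) (s : {set A + B}) :
  #|s| = (#|[set x | inl x \in s]| + #|[set y | inr y \in s]|)%N.
Proof.
by rewrite -sum1_card big_sumType /= !sum1dep_card.
Qed.

(** The composite relation is one-to-one, so its domain may be counted instead, separately over the
    vertices of [I2] and the unmatched ones of [I1]. *)
Lemma card_comp_rel : #|comp_rel r1 m r2| = comp_preserved P C setT m.
Proof.
rewrite -card_rel_dom; last exact: comp_one_to_one.
rewrite card_set_sum /comp_preserved addnAC; congr (_ + _)%N; last first.
  rewrite sum_bool_card setTD.
  rewrite -(card_imset _ (@val_inj _ _ {x : I1 | x \notin rel_im m})).
  apply: eq_card => x; rewrite !inE; apply/imsetP/andP.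
    move=> [u]; rewrite inE => /rel_domP[[y|y]]; rewrite inE //= => h ->.
    by split; [exact: (valP u)|exact: mem_rel_dom h].
  move=> [nx /rel_domP[y hy]]; exists (Sub x nx) => //; rewrite inE.
  by apply/rel_domP; exists (inl y); rewrite inE.
(* The vertices of [O2] through which an input of the right rule survives: unmatched, or matched to
   a vertex that the left rule preserves. Through [r2] they correspond to the part of the domain
   inside [I2]. *)
pose Y := [set y in C | (y \notin rel_dom m) || [exists x in P, (y, x) \in m]].
have -> : [set a | inl a \in rel_dom (comp_rel r1 m r2)] =
    fst @: [set p in r2 | p.2 \in Y].
  apply/setP => a; rewrite inE; apply/rel_domP/imsetP.
    move=> [[c|y]]; rewrite inE /=.
      move=> /existsP[y /existsP[x /and3P[h hm h1]]]; exists (a, y) => //.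
      rewrite !inE h (mem_rel_im h) /=; apply/orP; right; apply/exists_inP.
      by exists x => //; exact: mem_rel_dom h1.
    by move=> h; exists (a, val y) => //; rewrite !inE h (mem_rel_im h) (valP y).
  move=> [[a' y]]; rewrite !inE /= => /andP[h /andP[_]] hy ->; case/orP: hy => [ny|].
    by exists (inr (Sub y ny)); rewrite inE.
  move=> /exists_inP[x /rel_domP[c h1] hm]; exists (inl c); rewrite inE /=.
  by apply/existsP; exists y; apply/existsP; exists x; apply/and3P.
rewrite card_in_imset; last first.
  by apply: fst_inj; apply: one_to_oneS o2; apply/subsetP => p; rewrite inE => /andP[].
have -> : #|[set p in r2 | p.2 \in Y]| = #|Y|.
  rewrite -(card_in_imset (f := snd)); last first.
    by apply: snd_inj; apply: one_to_oneS o2; apply/subsetP => p; rewrite inE => /andP[].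
  apply: eq_card => y; apply/imsetP/idP => [[p]|hy].
    by rewrite inE => /andP[_ h] ->.
  have : y \in C by move: hy; rewrite inE => /andP[].
  by move=> /rel_imP[a ha]; exists (a, y) => //; rewrite inE ha.
rewrite -(cardsID (rel_dom m)) !sum_bool_card; congr (_ + _)%N; last first.
  apply: eq_card => y; rewrite !inE.
  by case: (y \in rel_dom m); case: (y \in C); rewrite ?andbF.
rewrite -(card_in_imset (f := fst) (D := mem [set p in m | _])); last first.
  by apply: fst_inj; apply: one_to_oneS om; apply/subsetP => p; rewrite inE => /andP[].
apply: eq_card => y; rewrite !inE; apply/andP/imsetP.
  move=> [/andP[yC /orP[/negPf -> //|/exists_inP[x xP h]] _]].
  by exists (y, x) => //; rewrite !inE h xP.
move=> [[y' x]]; rewrite !inE /= => /and3P[h xP yC] ->.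
split; last exact: mem_rel_dom h.
by rewrite yC /=; apply/orP; right; apply/exists_inP; exists x.
Qed.
End CompositeRelation.

(** * Products of edgeless rules in the rule algebra *)

Section Product.
Variables (K : fieldType) (T : rewriting_type).
Local Notation Q := (presented_algebra K).
Local Notation M := {malg K[(nat * nat * nat)%type]}.
Local Notation b := (count_basis K).
Local Notation RA := (rule_algebra K).

Definition count_rule : M -> RA :=
  linext (fun t : nat * nat * nat => << std_class t.1.1 t.1.2 t.2 >> : RA).
HB.instance Definition _ := GRing.Linear.on count_rule.

Lemma count_ruleE k l j : count_rule (b k l j) = << std_class k l j >>.
Proof. exact: linextU. Qed.

Lemma count_rule_coeff u k l j :
  mcoeff (std_class k l j) (count_rule u : {malg K[rule_class]}) = u@_(k, l, j).
Proof.
elim/malg_ind: u => [|c [[k' l'] j'] u IHu]; first by rewrite linear0 !mcoeff0.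
rewrite linearP; apply: etrans (mcoeffD _ _ _) _.
rewrite IHu mcoeffD; congr (_ + _); rewrite !mcoeffZ; congr (_ * _).
apply: etrans (congr1 (mcoeff _) (count_ruleE k' l' j')) _.
rewrite !mcoeffU; congr (_ *+ nat_of_bool _).
by apply/eqP/eqP => [/std_class_inj|[-> -> ->]].
Qed.

Lemma count_rule_inj : injective count_rule.
Proof. by move=> u v e; apply/malgP => -[[k l] j]; rewrite -!count_rule_coeff e. Qed.

Lemma delta_edgeless (VI EI VO EO : finType) (r : rule VI EI VO EO) k l j :
  (EI -> False) -> (EO -> False) ->
  #|(rule_rel r).1| = l -> #|VI| = (l + j)%N -> #|VO| = (l + k)%N ->
  delta K r = count_rule (b k l j).
Proof.
by move=> nI nO hl hI hO; rewrite count_ruleE /delta (class_of_edgeless nI nO hl hI hO).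
Qed.

Section Matches.
Variables (VI1 EI1 VO1 EO1 VI2 EI2 VO2 EO2 : finType).
Variables (r1 : rule VI1 EI1 VO1 EO1) (r2 : rule VI2 EI2 VO2 EO2).
Hypotheses (nI1 : EI1 -> False) (nO1 : EO1 -> False).
Hypotheses (nI2 : EI2 -> False) (nO2 : EO2 -> False).

(** Without output edges in the right rule, the edge part of a match is empty. *)
Lemma sum_match_of (V : zmodType) (G : {set VO2 * VI1} -> V) :
  \sum_(m : match_of r1 r2) G (val m).1 = \sum_(m | one_to_one m) G m.
Proof.
have P (s : {set VO2 * VI1}) : one_to_one s -> inj_pmor (out r2) (inp r1) (s, set0).
  move=> os; apply/and3P; split=> //; first exact: set0_one_to_one.
  by apply/forall_inP => e; rewrite inE.
rewrite [RHS](reindex_omap (fun m : match_of r1 r2 => (val m).1)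
  (fun s => insub (s, set0))) /=; last by move=> s /P h; rewrite insubT.
apply: eq_bigl => m; have /and3P[-> _ _] := valP m; rewrite andTb; apply/esym.
rewrite (_ : ((val m).1, set0) = val m) ?valK ?eqxx //.
case: m => -[s t] /= _; congr (_, _); apply/setP => -[e e']; case: (nO2 e).
Qed.

Variables (k1 l1 j1 k2 l2 j2 : nat).
Hypotheses (hl1 : #|(rule_rel r1).1| = l1) (hI1 : #|VI1| = (l1 + j1)%N)
           (hO1 : #|VO1| = (l1 + k1)%N).
Hypotheses (hl2 : #|(rule_rel r2).1| = l2) (hI2 : #|VI2| = (l2 + j2)%N)
           (hO2 : #|VO2| = (l2 + k2)%N).

Let P := rel_dom (rule_rel r1).1.
Let C := rel_im (rule_rel r2).1.

Let o1 : one_to_one (rule_rel r1).1. Proof. by have /and3P[] := rule_relP r1. Qed.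
Let o2 : one_to_one (rule_rel r2).1. Proof. by have /and3P[] := rule_relP r2. Qed.

Let cP : #|P| = l1. Proof. by rewrite card_rel_dom. Qed.
Let cC : #|C| = l2. Proof. by rewrite card_rel_im. Qed.

(** Without edges nothing dangles, so every composite is admissible for every [T], and its class is
    determined by counting vertices. *)
Lemma reduced_composite_edgeless (m : match_of r1 r2) :
  reduced_composite K T m =
  count_rule (b (k1 + comp_created P C (val m).1) (comp_preserved P C setT (val m).1)
                (comp_deleted P C j2 setT (val m).1)).
Proof.
have om : one_to_one (val m).1 by have /and3P[] := valP m.
have nI : comp_I EI2 (val m).2 -> False by case=> [e|[e _]]; [exact: nI2 e|exact: nI1 e].
have nO : comp_O EO1 (val m).2 -> False by case=> [e|[e _]]; [exact: nO1 e|exact: nO2 e].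
have -> : reduced_composite K T m = delta K (Rule (reductP m)).
  have hI : [forall e, ~~ dangling (composite_inp m) e].
    by apply/forallP => e; case: (nI e).
  have hO : [forall e, ~~ dangling (composite_out m) e].
    by apply/forallP => e; case: (nO e).
  by rewrite /reduced_composite /admissible hI hO; case: T.
apply: delta_edgeless; [by case=> e _; exact: nI e|by case=> e _; exact: nO e|..].
- exact: card_comp_rel.
- rewrite card_comp_I hI2 -cC /comp_preserved /comp_deleted setTD.
  have -> : #|~: rel_im (val m).1| =
      (\sum_(x in ~: rel_im (val m).1) ((x \in P) + (x \notin P)))%N.
    by rewrite -sum1_card; apply: eq_bigr => x _; case: (x \in P).
  have -> : #|C| = (\sum_(y : VO2) (y \in C))%N.
    by rewrite -sum1_card big_mkcond; apply: eq_bigr => y _; case: (y \in C).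
  (* The preserved output vertices of the right rule are split into matched ones, summed over the
     pairs of the match, and free ones. *)
  rewrite (bigID (mem (rel_dom (val m).1))) /= big_imset /=; last exact: fst_inj.
  rewrite (eq_bigl (mem (~: rel_dom (val m).1))) => [|y]; last by rewrite !inE.
  have -> : (\sum_(p in (val m).1) (p.1 \in C) =
      \sum_(p in (val m).1) ((p.2 \in P) && (p.1 \in C))
      + \sum_(p in (val m).1) ((p.2 \notin P) && (p.1 \in C)))%N.
    by rewrite -big_split; apply: eq_bigr => p _; case: (p.2 \in P); case: (p.1 \in C).
  by rewrite big_split /=; lia.
- rewrite card_comp_O hO1 -cP /comp_preserved /comp_created setTD.
  have -> : #|~: rel_dom (val m).1| =
      (\sum_(y in ~: rel_dom (val m).1) ((y \in C) + (y \notin C)))%N.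
    by rewrite -sum1_card; apply: eq_bigr => y _; case: (y \in C).
  have -> : #|P| = (\sum_(x : VI1) (x \in P))%N.
    by rewrite -sum1_card big_mkcond; apply: eq_bigr => x _; case: (x \in P).
  rewrite (bigID (mem (rel_im (val m).1))) /= big_imset /=; last exact: snd_inj.
  rewrite (eq_bigl (mem (~: rel_im (val m).1))) => [|x]; last by rewrite !inE.
  have -> : (\sum_(p in (val m).1) (p.2 \in P) =
      \sum_(p in (val m).1) ((p.2 \in P) && (p.1 \in C))
      + \sum_(p in (val m).1) ((p.2 \in P) && (p.1 \notin C)))%N.
    by rewrite -big_split; apply: eq_bigr => p _; case: (p.2 \in P); case: (p.1 \in C).
  by rewrite big_split /=; lia.
Qed.

Lemma sum_reduced_composite :
  \sum_(m : match_of r1 r2) reduced_composite K T m =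
  count_rule (normal_act k1 l1 j1 (b k2 l2 j2)).
Proof.
rewrite (eq_bigr _ (fun m _ => reduced_composite_edgeless m)) -linear_sum.
rewrite (sum_match_of (fun m => b (k1 + comp_created P C m)
  (comp_preserved P C setT m) (comp_deleted P C j2 setT m))) match_sumE.
have -> : #|~: P| = j1 by rewrite cardsCs setCK cP hI1 addKn.
have -> : #|~: C| = k2 by rewrite cardsCs setCK cC hO2 addKn.
by rewrite cP cC.
Qed.
End Matches.

Lemma repr_class_of (VI EI VO EO : finType) (r : rule VI EI VO EO) :
  rule_iso r (body (repr (class_of r))).
Proof.
apply: rule_iso_trans (number_rule_iso r) _; apply: rule_iso_sym.
by have /eqmodP/asboolP := reprK (class_of r).
Qed.

(** The representatives used by [mul_classes] are known only up to isomorphism, which is why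
    [sum_reduced_composite] asks for nothing but edgelessness and cardinals. *)
Lemma mul_std_classes k1 l1 j1 k2 l2 j2 :
  mul_classes K T (std_class k1 l1 j1) (std_class k2 l2 j2) =
  count_rule (normal_act k1 l1 j1 (b k2 l2 j2)).
Proof.
have h1 := repr_class_of (std_rule k1 l1 j1).
have h2 := repr_class_of (std_rule k2 l2 j2).
have [cI1 cO1 cl1] := rule_iso_card h1; have [cI2 cO2 cl2] := rule_iso_card h2.
have [nI1 nO1] := rule_iso_edgeless (rule_iso_sym h1).
have [nI2 nO2] := rule_iso_edgeless (rule_iso_sym h2).
apply: sum_reduced_composite.
- by apply: nI1; case.
- by apply: nO1; case.
- by apply: nI2; case.
- by apply: nO2; case.
- by rewrite -cl1 card_std_rel.
- by rewrite -cI1 card_sum !card_ord.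
- by rewrite -cO1 card_sum !card_ord.
- by rewrite -cl2 card_std_rel.
- by rewrite -cI2 card_sum !card_ord.
- by rewrite -cO2 card_sum !card_ord.
Qed.

Section Bilinear.
Implicit Types x y : RA.

Lemma rmulE x y :
  rmul T x y = linext (fun c1 => linext (fun c2 => mul_classes K T c1 c2 : RA) y) x.
Proof.
apply: eq_bigr => c1 _; rewrite /linext scaler_sumr; apply: eq_bigr => c2 _.
by rewrite scalerA.
Qed.

Lemma rmul_linear_l y : linear (fun x : {malg K[rule_class]} => rmul T x y : RA).
Proof. by move=> c x x'; rewrite !rmulE linext_linear. Qed.

Lemma rmul_linear_r x : linear (fun y : {malg K[rule_class]} => rmul T x y : RA).
Proof.
move=> c y y'; rewrite !rmulE; apply: etrans (eq_bigr _ (fun c1 _ =>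
  congr1 ( *:%R x@_c1) (linext_linear (fun c2 => mul_classes K T c1 c2 : RA) c y y'))) _.
rewrite [X in _ = X + _]scaler_sumr -big_split /=.
by apply: eq_bigr => c1 _; rewrite scalerDr !scalerA (mulrC c).
Qed.

Lemma rmulU c1 c2 : rmul T (<< c1 >> : RA) << c2 >> = mul_classes K T c1 c2.
Proof. by rewrite rmulE !linextU. Qed.
End Bilinear.

Lemma rmul_count_basis k1 l1 j1 k2 l2 j2 :
  rmul T (count_rule (b k1 l1 j1)) (count_rule (b k2 l2 j2)) =
  count_rule (vertex_act (normal_map (b k1 l1 j1)) (b k2 l2 j2)).
Proof.
by rewrite normal_mapE vertex_act_normal !count_ruleE rmulU mul_std_classes.
Qed.

Lemma rmul_count_rule u v :
  rmul T (count_rule u) (count_rule v) = count_rule (vertex_act (normal_map u) v).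
Proof.
have r0l (y : RA) : rmul T 0 y = 0 by rewrite rmulE linear0.
have r0r (x : RA) : rmul T x 0 = 0.
  by rewrite rmulE /linext big1 // => c _; rewrite -/(linext _ _) linear0 scaler0.
have a0 w : vertex_act (0 : Q) w = 0.
  by rewrite -(linear0 (quotient_pi (@vertex_relation K))) vertex_act_pi free_act0.
elim/malg_ind: u => [|c [[k1 l1] j1] u IHu]; first by rewrite !linear0 r0l a0 linear0.
rewrite (linearP count_rule) (linearP (@normal_map K)) rmul_linear_l vertex_act_linear.
rewrite (linearP count_rule); apply: congrZD IHu; clear u.
elim/malg_ind: v => [|c' [[k2 l2] j2] v IHv]; first by rewrite !linear0 r0r.
rewrite (linearP count_rule) (linearP (vertex_act _)) rmul_linear_r.
rewrite (linearP count_rule); apply: congrZD IHv; clear v.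
exact: rmul_count_basis.
Qed.
End Product.

(** * The embedding of the presented algebra *)

Section VertexEmbedding.
Variables (K : fieldType) (T : rewriting_type).
Local Notation Q := (presented_algebra K).
Local Notation M := {malg K[(nat * nat * nat)%type]}.
Local Notation b := (count_basis K).
Local Notation RA := (rule_algebra K).
Local Notation pg := (presented_gen K).

(** Sends [normal_elt k l j] to the class of the standard rule with these numbers. *)
Definition vertex_embedding (x : Q) : RA := count_rule (counts x).

Lemma vertex_embedding_linear : linear vertex_embedding.
Proof. by move=> c x y; rewrite /vertex_embedding !linearP. Qed.
HB.instance Definition _ :=
  GRing.isLinear.Build K Q RA _ vertex_embedding vertex_embedding_linear.

Lemma vertex_embedding1 : vertex_embedding 1 = r_empty K.
Proof.
rewrite /vertex_embedding counts1 /r_empty; apply/esym/delta_edgeless => //=.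
- exact: cards0.
- by rewrite card_void.
- by rewrite card_void.
Qed.

(** By [countsK], the operator by which the image of [x] multiplies is the action of [x] itself, and
    [countsM] turns it into the product. *)
Lemma vertex_embeddingM : {morph vertex_embedding : x y / x * y >-> rmul T x y}.
Proof.
by move=> x y; rewrite /vertex_embedding rmul_count_rule countsK countsM.
Qed.

Lemma vertex_embedding_inj : injective vertex_embedding.
Proof. exact: inj_comp (@count_rule_inj K) (can_inj (@countsK K)). Qed.

Lemma vertex_embedding_gen g : vertex_embedding (pg g) = gen_value K g.
Proof.
rewrite /vertex_embedding counts_gen; apply/esym.
by case: g; apply: delta_edgeless => //=; rewrite ?cards0 ?cards1 ?card_void ?card_unit.
Qed.

Lemma vertex_embeddingX x n : vertex_embedding (x ^+ n) = rpow T (vertex_embedding x) n.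
Proof.
elim: n => [|n IHn]; first by rewrite expr0 vertex_embedding1.
by rewrite exprS vertex_embeddingM IHn.
Qed.

Lemma vertex_embedding_normal m n p :
  vertex_embedding (pg Gadag ^+ m * pg GI ^+ n * pg Ga ^+ p) = normal_term K T m n p.
Proof. by rewrite !vertex_embeddingM !vertex_embeddingX !vertex_embedding_gen. Qed.

Lemma vertex_embedding_image y :
  vertex_algebra T y <-> exists x, vertex_embedding x = y.
Proof.
split=> [hy|[x <-] S [S1 SD SM] Sg].
  apply: (hy (fun z => exists x, vertex_embedding x = z)) => [|g]; last first.
    by exists (pg g); exact: vertex_embedding_gen.
  split=> [|c _ _ [x <-] [x' <-]|_ _ [x <-] [x' <-]].
  - by exists 1; exact: vertex_embedding1.
  - by exists (c *: x + x'); exact: vertex_embedding_linear.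
  - by exists (x * x'); exact: vertex_embeddingM.
elim/presented_ind: x => [|c x x' hx hx'|g x hx].
- by rewrite vertex_embedding1.
- by rewrite vertex_embedding_linear; exact: SD.
- rewrite vertex_embeddingM vertex_embedding_gen; exact: SM (Sg g) hx.
Qed.

Definition normal_word (t : nat * nat * nat) : Q :=
  pg Gadag ^+ t.1.1 * pg GI ^+ t.1.2 * pg Ga ^+ t.2.

Lemma fallingS_mul_exp (l n : nat) :
  falling (pg GI) l.+1 * pg GI ^+ n =
  falling (pg GI) l * pg GI ^+ n.+1 - (falling (pg GI) l * pg GI ^+ n) *+ l.
Proof. by rewrite fallingS mulrBr mulrBl mulr_natr -mulrA -exprS mulrnAl. Qed.

Lemma mul3Bn (x y z w : Q) n : x * (y - z *+ n) * w = x * y * w - (x * z * w) *+ n.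
Proof. by rewrite mulrBr mulrBl mulrnAr mulrnAl. Qed.

(** The power of [I] is carried along for the induction on [l]: expanding the last factor of the
    falling factorial either raises this power or multiplies by a number. *)
Lemma falling_normal_word k l n j : exists u : M,
  linext normal_word u = pg Gadag ^+ k * (falling (pg GI) l * pg GI ^+ n) * pg Ga ^+ j.
Proof.
elim: l n => [|l IHl] n.
  by exists (b k n j); apply: etrans (linextU _ _) _; rewrite /falling big_ord0 mul1r.
have [u hu] := IHl n.+1; have [v hv] := IHl n; exists (u - v *+ l).
pose f z := pg Gadag ^+ k * z * pg Ga ^+ j.
apply: etrans (esym (congr1 f (fallingS_mul_exp l n))).
apply: etrans (esym (mul3Bn _ _ _ _ _)).
apply: etrans (linearB _ _ _) (congr2 (fun y z => y - z) hu _).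
exact: etrans (linearMn _ _ _) (congr1 (fun z => z *+ l) hv).
Qed.

Lemma normal_word_span x : exists u : M, linext normal_word u = x.
Proof.
have [u <-] := normal_map_surj x.
elim/malg_ind: u => [|c [[k l] j] u [v hv]]; first by exists 0; rewrite !linear0.
have [w hw] := falling_normal_word k l 0 j; exists (c *: w + v).
apply: (etrans (linext_linear normal_word c w v)).
apply: (etrans _ (esym (linearP (@normal_map K) c _ u))).
apply: congrZD hv; apply: etrans hw (etrans _ (esym (normal_mapE K k l j))).
exact: (congr1 (fun z => pg Gadag ^+ k * z * pg Ga ^+ j) (mulr1 _)).
Qed.
End VertexEmbedding.

Theorem theorem6p1 (K : fieldType) (T : rewriting_type) :
  (exists f : {linear presented_algebra K -> rule_algebra K},
     [/\ f 1 = r_empty K,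
         {morph f : x y / x * y >-> rmul T x y},
         injective f,
         forall y, vertex_algebra T y <-> exists x, f x = y &
         forall g, f (presented_gen K g) = gen_value K g]) /\
  (forall x, vertex_algebra T x ->
     exists (s : seq (nat * nat * nat)) (c : nat * nat * nat -> K),
       x = \sum_(i <- s) c i *: normal_term K T i.1.1 i.1.2 i.2).
Proof.
split.
  exists (@vertex_embedding K); split.
  - exact: vertex_embedding1.
  - exact: vertex_embeddingM.
  - exact: vertex_embedding_inj.
  - exact: vertex_embedding_image.
  - exact: vertex_embedding_gen.
move=> _ /vertex_embedding_image[x <-]; have [u <-] := normal_word_span x.
(* The coefficients are those of a preimage under the span by ordered words, transported by the
   linear embedding. *)
exists (msupp u), (fun t => u@_t); rewrite /linext linear_sum.
apply: eq_bigr => t _; rewrite linearZ -vertex_embedding_normal; exact: erefl.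
Qed.
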